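(* Let $0\le k\le n$ and $S=\mathbb Z[\varepsilon_1,\dots,\varepsilon_k]$, acting on $\mathcal B_l(n,k)$ with $\varepsilon_i$ acting as multiplication by the central element $e_i(U_1,\dots,U_n)$ (elementary symmetric polynomial). Then $\mathcal B_l(n,k)$ is a free $S$-module with basis given by the fork elements $\mathsf p_{(\mathbf x,\mathbf z^\sigma,\mathbf y)}f_{\mathbf x,\mathbf y}$, where $\mathbf x,\mathbf y$ range over pairs in $V_l(n,k)$ that are not too far, $\sigma$ ranges over $S_k$, and $\mathbf z$ ranges over elements of $V_l(n,k)$ such that no two of $\mathbf x,\mathbf y,\mathbf z$ are too far and $\mathbf x\preceq\mathbf z\succeq\mathbf y$.
   Context: **Ozsváth–Szabó algebra.** Fix integers $n\ge 0$, $0\le k\le n$. An I-state is a subset $\mathbf x\subset\{0,\dots,n\}$; it is a left I-state if $n\notin\mathbf x$. $V(n,k)$ (resp. $V_l(n,k)$) is the set of I-states (resp. left I-states) with $k$ elements, $\mathbf x=\{x_1<\dots<x_k\}$. $\mathbf x,\mathbf y\in V(n,k)$ are too far if $|x_i-y_i|>1$ for some $i$. For $1\le i\le n$ put $v_i^{\mathbf x}=|\mathbf x\cap\{i,\dots,n\}|$. $\mathcal B_0(n,k)$ is the $\mathbb Z[U_1,\dots,U_n]$-algebra which is free as a module on elements $f_{\mathbf x,\mathbf y}$ ($\mathbf x,\mathbf y\in V(n,k)$), with $f_{\mathbf x,\mathbf y}f_{\mathbf y,\mathbf z}=\prod_{i=1}^nU_i^{g_i}f_{\mathbf x,\mathbf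 z}$, $g_i=\tfrac12(|v_i^{\mathbf y}-v_i^{\mathbf z}|-|v_i^{\mathbf x}-v_i^{\mathbf z}|+|v_i^{\mathbf x}-v_i^{\mathbf y}|)$, and $f_{\mathbf x,\mathbf y}f_{\mathbf w,\mathbf z}=0$ for $\mathbf y\ne\mathbf w$. The $\mathbf I_{\mathbf x}=f_{\mathbf x,\mathbf x}$ are orthogonal idempotents with sum $1$. For $1\le i\le n$, $R_i=\sum f_{\mathbf x,(\mathbf x\setminus\{i-1\})\cup\{i\}}$ over $\mathbf x$ with $\mathbf x\cap\{i-1,i\}=\{i-1\}$, and $L_i=\sum f_{\mathbf x,(\mathbf x\setminus\{i\})\cup\{i-1\}}$ over $\mathbf x$ with $\mathbf x\cap\{i-1,i\}=\{i\}$. $\mathcal B(n,k)$ is the quotient of $\mathcal B_0(n,k)$ by the two-sided ideal generated by $R_{i-1}R_i$, $L_iL_{i-1}$ ($2\le i\le n$) and $U_i\mathbf I_{\mathbf x}$ ($1\le i\le n$, $\mathbf x\cap\{i-1,i\}=\varnothing$). $\mathcal B_l(n,k)=e\,\mathcal B(n,k)\,e$ with $e=\sum_{\mathbf x\in V_l(n,k)}\mathbf I_{\mathbf x}$. **Generating intervals.** For $\mathbf x,\mathbf y\in V(n,k)$ not too far, region $i\in\{0,\dots,n\}$ is fully used if $i\in\mathbf x\cap\mathbf y$; line $j\in\{1,\dots,n\}$ is uncrossed if $v_j^{\mathbf x}=v_j^{\mathbf y}$. A generating interval is a set $[j+1,j+l]=\{j+1,\dots,j+l\}\subset\{1,\dots,n\}$,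 $l\ge1$, such that regions $j$ and $j+l$ are not fully used, regions $j+1,\dots,j+l-1$ are fully used, and lines $j+1,\dots,j+l$ are uncrossed. There are $n-k$ generating intervals, listed from left to right as $[j_i+1,j_i+l_i]$, $1\le i\le n-k$. **Fork polynomials.** Partial order: $\mathbf x\succeq\mathbf y$ iff $x_i\le y_i$ for all $i$. The hole sequence of $\mathbf z$ is $\{0,\dots,n\}\setminus\mathbf z=\{h_1^{\mathbf z}<\dots<h_{n-k+1}^{\mathbf z}\}$. For $\sigma\in S_k$ let $\mathfrak S'_\sigma(y_1,\dots,y_k)=\prod_{i=1}^ky_i^{c_i}$ with $c_i=\#\{j<\sigma^{-1}(i):\sigma(j)>i\}$. For $\mathbf x,\mathbf y,\mathbf z\in V_l(n,k)$ pairwise not too far with $\mathbf x\preceq\mathbf z\succeq\mathbf y$ and $[j_i+1,j_i+l_i]$ the generating intervals for $\mathbf x,\mathbf y$, $$\mathsf p_{(\mathbf x,\mathbf z^\sigma,\mathbf y)}=\mathfrak S'_\sigma(U_{z_1+1},\dots,U_{z_k+1})\prod_{i=1}^{n-k}U_{j_i+1}U_{j_i+2}\cdots U_{h_i^{\mathbf z}}\in\mathbb Z[U_1,\dots,U_n]$$ (the $i$-th factor being $1$ if $h_i^{\mathbf z}=j_i$). *)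

(* Defs.v *)
From HB Require Import structures.
From mathcomp Require Import all_boot all_order all_algebra all_fingroup.
From mathcomp Require Import generic_quotient ring_quotient zify ring.
From mathcomp Require Import mpoly boolp.

Set Implicit Arguments.
Unset Strict Implicit.
Unset Printing Implicit Defensive.

Import GRing.Theory.
Local Open Scope ring_scope.
Local Open Scope quotient_scope.

Section RingQuotientType.
Variables (R : pzRingType) (G : R -> Prop).

Inductive gen_ideal : R -> Prop :=
| gen_ideal_in a of G a : gen_ideal a
| gen_ideal0 : gen_ideal 0
| gen_idealB a b of gen_ideal a & gen_ideal b : gen_ideal (a - b)
| gen_idealMl r a of gen_ideal a : gen_ideal (r * a)
| gen_idealMr r a of gen_ideal a : gen_ideal (a * r).

Definition gen_ideal_pred : R -> bool := fun a => `[< gen_ideal a >].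

Lemma gen_ideal_zmod : zmod_closed gen_ideal_pred.
Proof.
split; first by apply/asboolP; exact: gen_ideal0.
by move=> a b /asboolP Ia /asboolP Ib; apply/asboolP; exact: gen_idealB.
Qed.

Definition gen_ideal_zclosed : zmodClosed R :=
  HB.pack gen_ideal_pred (GRing.isZmodClosed.Build R gen_ideal_pred gen_ideal_zmod).

Definition ring_quot : Type := Quotient.quot gen_ideal_zclosed.

HB.instance Definition _ := GRing.Zmodule.on ring_quot.

End RingQuotientType.

(* Locked so that failed conversion checks do not unfold [repr] or polynomial
   arithmetic. *)
HB.lock Definition qpi (R : pzRingType) (G : R -> Prop) (a : R) : ring_quot G :=
  \pi_(Quotient.quot (gen_ideal_zclosed G)) a.

HB.lock Definition qrepr (R : pzRingType) (G : R -> Prop) (q : ring_quot G) : R :=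
  repr (q : Quotient.quot (gen_ideal_zclosed G)).

HB.lock Definition qmul (R : pzRingType) (G : R -> Prop) (p q : ring_quot G) :
  ring_quot G := qpi G (qrepr p * qrepr q).

Section RingQuotientRing.
Variables (R : pzRingType) (G : R -> Prop).
Local Notation ring_quot := (ring_quot G).
Local Notation qpi := (@qpi R G).
Local Notation qmul := (@qmul R G).
Local Notation gen_ideal := (gen_ideal G).
Implicit Types p q r : ring_quot.

Lemma qreprK q : qpi (qrepr q) = q.
Proof. by rewrite qpi.unlock qrepr.unlock; exact: reprK. Qed.

Lemma qpi_eq a b : qpi a = qpi b <-> gen_ideal (a - b).
Proof.
rewrite qpi.unlock; split => [/eqP|Iab].
  by rewrite -Quotient.idealrBE => /asboolP.
by apply/eqP; rewrite -Quotient.idealrBE; apply/asboolP.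
Qed.

Lemma qpiB a b : qpi (a - b) = qpi a - qpi b.
Proof. by rewrite qpi.unlock !piE. Qed.

Lemma qpiD a b : qpi (a + b) = qpi a + qpi b.
Proof. by rewrite qpi.unlock !piE. Qed.

Lemma qpiM_subproof a b : qpi (a * b) = qmul (qpi a) (qpi b).
Proof.
set a' := qrepr (qpi a); set b' := qrepr (qpi b).
have Ia : gen_ideal (a - a') by apply/qpi_eq; rewrite qreprK.
have Ib : gen_ideal (b - b') by apply/qpi_eq; rewrite qreprK.
rewrite qmul.unlock; apply/qpi_eq; rewrite -/a' -/b'.
have -> : a * b - a' * b' = (a - a') * b - a' * (b' - b).
  by rewrite mulrBl mulrBr opprB addrA subrK.
apply: gen_idealB; first exact: gen_idealMr.
apply: gen_idealMl; rewrite -opprB -sub0r.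
by apply: gen_idealB => //; exact: gen_ideal0.
Qed.

Lemma qmulA : associative qmul.
Proof.
move=> p q r; rewrite -[p]qreprK -[q]qreprK -[r]qreprK.
by rewrite -!qpiM_subproof mulrA.
Qed.
Lemma qmul1r : left_id (qpi 1) qmul.
Proof. by move=> p; rewrite -[p]qreprK -qpiM_subproof mul1r. Qed.
Lemma qmulr1 : right_id (qpi 1) qmul.
Proof. by move=> p; rewrite -[p]qreprK -qpiM_subproof mulr1. Qed.
Lemma qmulDl : left_distributive qmul +%R.
Proof.
move=> p q r; rewrite -[p]qreprK -[q]qreprK -[r]qreprK.
by rewrite -qpiD -!qpiM_subproof mulrDl qpiD.
Qed.
Lemma qmulDr : right_distributive qmul +%R.
Proof.
move=> p q r; rewrite -[p]qreprK -[q]qreprK -[r]qreprK.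
by rewrite -qpiD -!qpiM_subproof mulrDr qpiD.
Qed.

HB.instance Definition _ :=
  GRing.Zmodule_isPzRing.Build ring_quot qmulA qmul1r qmulr1 qmulDl qmulDr.

HB.instance Definition _ := GRing.isZmodMorphism.Build R ring_quot qpi qpiB.
HB.instance Definition _ := GRing.isMonoidMorphism.Build R ring_quot qpi
  (erefl, qpiM_subproof).

Lemma qpiM a b : qpi (a * b) = qpi a * qpi b.
Proof. exact: qpiM_subproof. Qed.

End RingQuotientRing.

Section Corner.
Variables (R : pzRingType) (e : R).

Definition corner_pred : R -> bool := fun b => `[< exists a, b = e * a * e >].

Lemma corner_zmod : zmod_closed corner_pred.
Proof.
split; first by apply/asboolP; exists 0; rewrite mulr0 mul0r.
move=> _ _ /asboolP[a ->] /asboolP[b ->]; apply/asboolP; exists (a - b).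
by rewrite mulrBr mulrBl.
Qed.

Record corner := Corner { corner_val : R; cornerP : corner_pred corner_val }.

HB.instance Definition _ := [isSub for corner_val].
HB.instance Definition _ := [Choice of corner by <:].
HB.instance Definition _ :=
  GRing.SubChoice_isSubZmodule.Build R corner_pred corner corner_zmod.

End Corner.

Definition is_basis (A : pzRingType) (M : lmodType A) (I : finType)
    (v : I -> M) : Prop :=
  (forall m, exists c : I -> A, m = \sum_i c i *: v i) /\
  (forall c : I -> A, \sum_i c i *: v i = 0 -> forall i, c i = 0).

Record istate (n k : nat) :=
  IState { ist_set :> {set 'I_n.+1}; _ : #|ist_set| == k }.

HB.instance Definition _ n k := [isSub for @ist_set n k].
HB.instance Definition _ n k := [Finite of istate n k by <:].

Section OSModule.
Variables n k : nat.
Local Notation V := (istate n k).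
Local Notation ZU := {mpoly int[n]}.
Implicit Types x y z w : V.

Definition left_ist x : bool := ord_max \notin (x : {set _}).

(* [enum] lists a set of ordinals in increasing order; indices are shifted by
   one: [el x i] is x_(i+1) and [hole z i] is h_(i+1). *)
Definition elts x : seq nat := [seq val i | i <- enum (x : {set _})].
Definition el x (i : nat) : nat := nth 0%N (elts x) i.
Definition holes z : seq nat := [seq val i | i <- enum (~: (z : {set _}))].
Definition hole z (i : nat) : nat := nth 0%N (holes z) i.

Definition not_far x y : bool :=
  [forall i : 'I_k, `|(el x i)%:Z - (el y i)%:Z| <= 1].

Definition v x (i : nat) : nat := #|[set j in (x : {set _}) | (i <= j)%N]|.

Definition vdist x y (i : nat) : nat := absz ((v x i)%:Z - (v y i)%:Z).

(* Neither the truncated subtraction nor the halving loses anything, by the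
   triangle inequality and parity. *)
Definition gexp x y z (i : nat) : nat :=
  (vdist y z i + vdist x y i - vdist x z i)./2.

Lemma gexp_assoc x y z w i :
  (gexp x y z i + gexp x z w i = gexp y z w i + gexp x y w i)%N.
Proof. rewrite /gexp /vdist; lia. Qed.

(* Lines are numbered by i : 'I_n, standing for line i + 1, which separates
   regions i and i + 1; thus U_(i+1) is 'X_i. *)
Definition Ug x y z : ZU := \prod_(i < n) 'X_i ^+ gexp x y z i.+1.

Definition B0 : Type := {ffun V * V -> ZU^o}.

HB.instance Definition _ := GRing.Lmodule.on B0.

Lemma Ug_assoc x y z w : Ug x y z * Ug x z w = Ug y z w * Ug x y w.
Proof.
rewrite /Ug -!big_split; apply: eq_bigr => i _ /=.
by rewrite -!exprD gexp_assoc.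
Qed.

Lemma Ugl x z : Ug x x z = 1.
Proof.
rewrite /Ug big1 // => i _; suff -> : gexp x x z i.+1 = 0%N by rewrite expr0.
by rewrite /gexp /vdist; lia.
Qed.

Lemma Ugr x z : Ug x z z = 1.
Proof.
rewrite /Ug big1 // => i _; suff -> : gexp x z z i.+1 = 0%N by rewrite expr0.
by rewrite /gexp /vdist; lia.
Qed.

End OSModule.

HB.lock Definition coef n k (a : B0 n k) (x y : istate n k) : {mpoly int[n]} :=
  a (x, y).

HB.lock Definition f n k (x y : istate n k) : B0 n k :=
  [ffun p => ((p == (x, y))%:R : {mpoly int[n]})].

HB.lock Definition B0mul n k (a b : B0 n k) : B0 n k :=
  [ffun p =>
    (\sum_y Ug p.1 y p.2 * coef a p.1 y * coef b y p.2 : {mpoly int[n]})].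

Section OSAlgebra.
Variables n k : nat.
Local Notation V := (istate n k).
Local Notation ZU := {mpoly int[n]}.
Local Notation B0 := (B0 n k).
Local Notation B0mul := (@B0mul n k).
Implicit Types x y z w : V.

Lemma coefP (a b : B0) : (forall x y, coef a x y = coef b x y) -> a = b.
Proof. rewrite coef.unlock; by move=> ab; apply/ffunP => -[x y]; exact: ab. Qed.

Lemma coef0 x y : coef 0 x y = 0.
Proof. by rewrite coef.unlock ffunE. Qed.

Lemma coefD a b x y : coef (a + b) x y = coef a x y + coef b x y.
Proof. by rewrite coef.unlock ffunE. Qed.

Lemma coef_sum (I : finType) (P : pred I) (F : I -> B0) x y :
  coef (\sum_(i | P i) F i) x y = \sum_(i | P i) coef (F i) x y.
Proof. by rewrite coef.unlock sum_ffunE. Qed.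

Lemma coefZ (c : ZU) (a : B0) x y : coef (c *: a) x y = c * coef a x y.
Proof. by rewrite coef.unlock ffunE. Qed.

Lemma coef_f x y z w : coef (f x y) z w = ((z == x) && (w == y))%:R.
Proof. by rewrite coef.unlock f.unlock ffunE xpair_eqE. Qed.

Lemma coef_mul a b x z :
  coef (B0mul a b) x z = \sum_(y : V) Ug x y z * coef a x y * coef b y z.
Proof. by rewrite coef.unlock B0mul.unlock ffunE coef.unlock. Qed.

Definition B0one : B0 := \sum_(x : V) f x x.

Lemma coef_one x y : coef B0one x y = (x == y)%:R.
Proof.
rewrite /B0one coef_sum (bigD1 x) //= coef_f eqxx big1 ?addr0 => [|z zx].
  by rewrite eq_sym.
by rewrite coef_f eq_sym (negPf zx).
Qed.

Lemma B0mulA : associative B0mul.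
Proof.
move=> a b c; apply: coefP => x w; rewrite !coef_mul.
under eq_bigr => y _ do rewrite coef_mul mulr_sumr.
under [RHS]eq_bigr => z _ do rewrite coef_mul mulr_sumr mulr_suml.
rewrite exchange_big; apply: eq_bigr => z _; apply: eq_bigr => y _ /=.
transitivity ((Ug y z w * Ug x y w) * (coef a x y * coef b y z * coef c z w)).
  by ring.
by rewrite -Ug_assoc; ring.
Qed.

Lemma B0mul1r : left_id B0one B0mul.
Proof.
move=> a; apply: coefP => x z; rewrite coef_mul (bigD1 x) //= big1 => [|y yx].
  by rewrite coef_one eqxx Ugl !mul1r addr0.
by rewrite coef_one eq_sym (negPf yx) mulr0 mul0r.
Qed.

Lemma B0mulr1 : right_id B0one B0mul.
Proof.
move=> a; apply: coefP => x z; rewrite coef_mul (bigD1 z) //= big1 => [|y yx].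
  by rewrite coef_one eqxx Ugr mul1r mulr1 addr0.
by rewrite coef_one (negPf yx) mulr0.
Qed.

Lemma B0mulDl : left_distributive B0mul +%R.
Proof.
move=> a b c; apply: coefP => x z; rewrite coefD !coef_mul -big_split.
by apply: eq_bigr => y _; rewrite coefD /= mulrDr mulrDl.
Qed.

Lemma B0mulDr : right_distributive B0mul +%R.
Proof.
move=> a b c; apply: coefP => x z; rewrite coefD !coef_mul -big_split.
by apply: eq_bigr => y _; rewrite coefD /= mulrDr.
Qed.

HB.instance Definition _ :=
  GRing.Zmodule_isPzRing.Build B0 B0mulA B0mul1r B0mulr1 B0mulDl B0mulDr.

Lemma coefM (a b : B0) x z :
  coef (a * b) x z = \sum_(y : V) Ug x y z * coef a x y * coef b y z.
Proof. exact: coef_mul. Qed.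

Lemma B0_scaleAl (c : ZU) (a b : B0) : c *: (a * b) = (c *: a) * b.
Proof.
apply: coefP => x z; rewrite coefZ !coefM mulr_sumr.
by apply: eq_bigr => y _; rewrite coefZ; ring.
Qed.

Lemma B0_scaleAr (c : ZU) (a b : B0) : c *: (a * b) = a * (c *: b).
Proof.
apply: coefP => x z; rewrite coefZ !coefM mulr_sumr.
by apply: eq_bigr => y _; rewrite coefZ; ring.
Qed.

Lemma fM x y w z : f x y * f w z = if y == w then Ug x y z *: f x z else 0.
Proof.
apply: coefP => s t; rewrite coefM (bigD1 y) //= big1 => [|u uy].
  rewrite !coef_f eqxx andbT addr0.
  have [_|_] := eqVneq y w; last by rewrite mulr0 coef0.
  rewrite coefZ coef_f /=.
  have [->|_] := eqVneq s x; last by rewrite /= mulr0 mul0r mulr0.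
  by have [->|_] := eqVneq t z; rewrite /= ?mulr1 ?mulr0.
by rewrite !coef_f (negPf uy) andbF mulr0 mul0r.
Qed.

Lemma B0_expand (a : B0) : a = \sum_(p : V * V) coef a p.1 p.2 *: f p.1 p.2.
Proof.
apply: coefP => x y; rewrite coef_sum (bigD1 (x, y)) //= big1 => [|[z w] zw].
  by rewrite coefZ coef_f !eqxx mulr1 addr0.
rewrite coefZ coef_f; move: zw; rewrite xpair_eqE [x == _]eq_sym [y == _]eq_sym.
by move/negPf => /= ->; rewrite mulr0.
Qed.

Definition lreg (i : 'I_n) : 'I_n.+1 := widen_ord (leqnSn n) i.
Definition rreg (i : 'I_n) : 'I_n.+1 := lift ord0 i.

Definition Rgen (i : 'I_n) : B0 :=
  \sum_(p : V * V |
      ((p.1 : {set _}) :&: [set lreg i; rreg i] == [set lreg i]) &&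
      ((p.2 : {set _}) == (p.1 :\ lreg i) :|: [set rreg i])) f p.1 p.2.

Definition Lgen (i : 'I_n) : B0 :=
  \sum_(p : V * V |
      ((p.1 : {set _}) :&: [set lreg i; rreg i] == [set rreg i]) &&
      ((p.2 : {set _}) == (p.1 :\ rreg i) :|: [set lreg i])) f p.1 p.2.

Inductive B_rel : B0 -> Prop :=
| B_rel_RR (i j : 'I_n) of j = i.+1 :> nat : B_rel (Rgen i * Rgen j)
| B_rel_LL (i j : 'I_n) of j = i.+1 :> nat : B_rel (Lgen j * Lgen i)
| B_rel_UI (i : 'I_n) x of (x : {set _}) :&: [set lreg i; rreg i] = set0 :
    B_rel (('X_i : ZU) *: f x x).

Definition B : Type := ring_quot B_rel.
HB.instance Definition _ := GRing.PzRing.on B.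

Definition piB : B0 -> B := @qpi B0 B_rel.
HB.instance Definition _ := GRing.RMorphism.on piB.

Lemma piBM a b : piB (a * b) = piB a * piB b.
Proof. exact: qpiM. Qed.

Definition e_left : B := piB (\sum_(x : V | left_ist x) f x x).

Definition Bl : Type := corner e_left.
HB.instance Definition _ := GRing.Zmodule.on Bl.

Definition U_act (c : ZU) : B := piB (c *: (1 : B0)).

(* eps_(i+1) acts as the elementary symmetric polynomial e_(i+1) in the U's. *)
Definition eps_act (c : {mpoly int[k]}) : ZU :=
  c \mPo [tuple mesym n int i.+1 | i < k].

Lemma U_actC c (b : B) : U_act c * b = b * U_act c.
Proof.
by rewrite -[b]qreprK -!(rmorphM piB) -B0_scaleAl -B0_scaleAr mul1r mulr1.
Qed.

Lemma U_actM c d : U_act (c * d) = U_act c * U_act d.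
Proof. by rewrite -(rmorphM piB) -B0_scaleAl mul1r scalerA. Qed.

Lemma U_actD c d : U_act (c + d) = U_act c + U_act d.
Proof. by rewrite -(raddfD piB) -scalerDl. Qed.

Lemma U_act1 : U_act 1 = 1.
Proof. by rewrite /U_act scale1r (rmorph1 piB). Qed.

Lemma U_act_corner c (b : Bl) : corner_pred e_left (U_act c * corner_val b).
Proof.
have /asboolP[a ->] := cornerP b; apply/asboolP; exists (U_act c * a).
by rewrite !mulrA -U_actC.
Qed.

Definition Bl_scale (c : {mpoly int[k]}) (b : Bl) : Bl :=
  Corner (U_act_corner (eps_act c) b).

Lemma Bl_scaleA c d b : Bl_scale c (Bl_scale d b) = Bl_scale (c * d) b.
Proof. by apply: val_inj; rewrite /= /eps_act rmorphM /= U_actM mulrA. Qed.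
Lemma Bl_scale1 : left_id 1 Bl_scale.
Proof. by move=> b; apply: val_inj; rewrite /= /eps_act rmorph1 U_act1 mul1r. Qed.
Lemma Bl_scaleDr : right_distributive Bl_scale +%R.
Proof. by move=> c a b; apply: val_inj; rewrite /= mulrDr. Qed.
Lemma Bl_scaleDl b : {morph Bl_scale^~ b : c d / c + d}.
Proof.
by move=> c d; apply: val_inj; rewrite /= /eps_act rmorphD /= U_actD mulrDl.
Qed.

HB.instance Definition _ := GRing.Zmodule_isLmodule.Build {mpoly int[k]} Bl
  Bl_scaleA Bl_scale1 Bl_scaleDr Bl_scaleDl.

Definition fully_used x y (i : nat) : bool := (i \in elts x) && (i \in elts y).
Definition uncrossed x y (j : nat) : bool := v x j == v y j.

(* The pair [(j, l)] stands for the interval {j + 1, ..., j + l}. *)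
Definition gen_interval x y (jl : nat * nat) : bool :=
  let: (j, l) := jl in
  [&& (1 <= l)%N, (j + l <= n)%N,
      ~~ fully_used x y j, ~~ fully_used x y (j + l),
      all (fully_used x y) (iota j.+1 l.-1) & all (uncrossed x y) (iota j.+1 l)].

(* The row-major order of the enumeration lists intervals from left to right. *)
Definition gen_intervals x y : seq (nat * nat) :=
  [seq jl <- [seq (j, l) | j <- iota 0 n, l <- iota 1 n] | gen_interval x y jl].

(* [ist_ge x y] is the order x >= y, under which smaller entries are larger. *)
Definition ist_ge x y : bool := [forall i : 'I_k, (el x i <= el y i)%N].

Definition schubert_code (s : 'S_k) (i : 'I_k) : nat :=
  #|[set j : 'I_k | (j < (s^-1)%g i)%N && (i < s j)%N]|.

Definition schubert' (s : 'S_k) : {mpoly int[k]} :=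
  \prod_(i < k) 'X_i ^+ schubert_code s i.

(* [U m] is U_m for 1 <= m <= n, and 0 outside this range. *)
Definition U (m : nat) : ZU := \sum_(i < n | m == i.+1) 'X_i.

Definition fork_poly x z (s : 'S_k) y : ZU :=
  (schubert' s \mPo [tuple U (el z i).+1 | i < k]) *
  \prod_(i < n - k)
    let j := (nth (0%N, 0%N) (gen_intervals x y) i).1 in
    \prod_(j.+1 <= m < (hole z i).+1) U m.

Definition fork_cond (t : V * V * V * 'S_k) : bool :=
  let x := t.1.1.1 in let z := t.1.1.2 in let y := t.1.2 in
  [&& left_ist x, left_ist y, left_ist z,
      not_far x y, not_far x z, not_far z y, ist_ge z x & ist_ge z y].

Record fork_index := ForkIndex {
  fork : V * V * V * 'S_k;
  fork_indexP : fork_cond fork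
}.

HB.instance Definition _ := [isSub for fork].
HB.instance Definition _ := [Finite of fork_index by <:].

Definition fork_x (t : fork_index) : V := (fork t).1.1.1.
Definition fork_z (t : fork_index) : V := (fork t).1.1.2.
Definition fork_y (t : fork_index) : V := (fork t).1.2.
Definition fork_s (t : fork_index) : 'S_k := (fork t).2.

Lemma f_left c x y : left_ist x -> left_ist y ->
  corner_pred e_left (piB (c *: f x y)).
Proof.
move=> lx ly; apply/asboolP; exists (piB (c *: f x y)).
rewrite /e_left; set E := \sum_(x | _) _.
have El : E * (c *: f x y) = c *: f x y.
  rewrite -B0_scaleAr mulr_suml (bigD1 x) //= fM eqxx Ugl scale1r big1 ?addr0 //.
  by move=> z /andP[_ zx]; rewrite fM (negPf zx).
have Er : (c *: f x y) * E = c *: f x y.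
  rewrite -B0_scaleAl mulr_sumr (bigD1 y) //= fM eqxx Ugr scale1r big1 ?addr0 //.
  by move=> z /andP[_ zy]; rewrite fM eq_sym (negPf zy).
by rewrite -(piBM E) El -piBM Er.
Qed.

Lemma fork_elt_subproof (t : fork_index) :
  corner_pred e_left
    (piB (fork_poly (fork_x t) (fork_z t) (fork_s t) (fork_y t) *:
          f (fork_x t) (fork_y t))).
Proof. by apply: f_left; have /and3P[] := fork_indexP t. Qed.

Definition fork_elt (t : fork_index) : Bl := Corner (fork_elt_subproof t).

End OSAlgebra.

(* Main.v *)
From HB Require Import structures.
Require Import Defs.
From mathcomp Require Import all_boot all_algebra mpoly.
From mathcomp Require Import all_fingroup zify ring boolp.

(** Write v x m for the number of elements of the state x that are at least m.
    A state is its function v x, a descent from k to 0 by steps of 0 or 1, and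
    all conditions of the theorem are inequalities between such functions: the
    condition relating the z of a fork to x says that v x (m + 1) lies between
    v z (m + 1) and v z m, and we say then that z covers x. For a left state z
    this holds as soon as v x (m + 1) = v z (m + 1) for every m < n outside z
    ([covers_of_holes]).

    Independence. Sending to zero the variables U_(m+1) with m outside z maps
    Z[U] onto a polynomial ring in the k variables U_(z_i + 1); this is
    [restrict z]. Applied to the (x, y) coefficients with x and y covered by z,
    it kills the whole ideal of relations ([gen_ideal_restrict]): if x and y
    are covered by z and w is not, then v w differs from v x and v y at some
    line m + 1 with m outside z, so that the structure constant of
    f_(x,w) f_(w,y) contains U_(m+1). The fork polynomial is a Schubert
    monomial in the U_(z_i + 1) times the squarefree monomial [gap x y z],
    where the exponent of U_(m+1) is min (v x (m + 1)) (v y (m + 1)) minus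
    v z (m + 1) ([fork_polyE]; the generating intervals begin at the holes of
    the meet of x and y). Under [restrict z] the gap of z' survives only if z
    covers z', which forces the total of v z' to exceed that of v z unless
    z' = z, and the gap of z itself is not killed. The fork elements are thus
    triangular with respect to the evaluations, and on the diagonal one is left
    with a relation between the monomials prod y_i^(c_i), 0 <= c_i < k - i for
    0 <= i < k, over the symmetric polynomials in k variables. These monomials
    are Artin's basis ([artin_free], [artin_span]), and their exponents are the
    Lehmer codes of the permutations ([schubert_code_inj],
    [schubert_code_surj]).

    Generation. Filter Z[U] f_(x,y) by the multiples of the monomials
    [gap x y z]. Modulo the variables killed by [restrict z], such a multiple
    reduces to fork elements by Artin's theorem; the multiples of
    [gap x y z] U_(m+1) with m outside z are multiples of [gap x y z'], where z'
    is obtained from z by moving the element m + 1 to m, when z' still covers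
    x and y, and otherwise they contain all the variables of a generating
    interval and vanish in the quotient ([ideal_gap_stop]). The filtration
    starts at the meet of x and y, whose gap is 1, provided that x and y are
    not too far. If they are, f_(x,y) itself is a relation
    ([ideal_too_far]). *)

Set Implicit Arguments.
Unset Strict Implicit.
Unset Printing Implicit Defensive.

Import GRing.Theory.
Local Open Scope ring_scope.

(** * Counting functions of I-states *)

Section States.
Local Open Scope nat_scope.
Variables n k : nat.
Local Notation V := (istate n k).
Implicit Types x y z w : V.

Lemma mem_elts x (i : 'I_n.+1) : (val i \in elts x) = (i \in (x : {set _})).
Proof. by rewrite /elts mem_map ?mem_enum //; apply: val_inj. Qed.

Lemma elts_le x j : j \in elts x -> j <= n.
Proof. by case/mapP => i _ ->; rewrite -ltnS ltn_ord. Qed.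

Lemma elts_filter x : elts x = [seq j <- iota 0 n.+1 | j \in elts x].
Proof.
rewrite -val_enum_ord filter_map /elts; congr map.
by rewrite {1}/enum_mem -enumT; apply: eq_filter => i /=; rewrite mem_elts.
Qed.

Lemma holes_filter x : holes x = [seq j <- iota 0 n.+1 | j \notin elts x].
Proof.
rewrite -val_enum_ord filter_map /holes; congr map.
by rewrite {1}/enum_mem -enumT; apply: eq_filter => i /=; rewrite mem_elts inE.
Qed.

Lemma elts_sorted x : sorted ltn (elts x).
Proof. by rewrite elts_filter sorted_filter ?iota_ltn_sorted //; apply: ltn_trans. Qed.

Lemma size_elts x : size (elts x) = k.
Proof. by rewrite size_map -cardE; case: x => s /= /eqP. Qed.

Lemma v_count x m : v x m = count (leq m) (elts x).
Proof.
rewrite /v /elts count_map -size_filter cardE; congr size.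
rewrite /enum_mem -filter_predI; apply: eq_filter => i /=.
by rewrite !inE andbC.
Qed.

Lemma v0 x : v x 0 = k.
Proof. by rewrite v_count (eq_count (a2 := predT)) // count_predT size_elts. Qed.

Lemma v_gt x m : n < m -> v x m = 0.
Proof.
move=> nm; rewrite v_count; apply/eqP; rewrite -leqn0 leqNgt -has_count.
by apply/hasPn => j /elts_le jn; rewrite -ltnNge; lia.
Qed.

Lemma v_step x j : v x j = (j \in elts x) + v x j.+1.
Proof.
rewrite !v_count.
have -> : (j \in elts x) = count_mem j (elts x) :> nat.
  by rewrite count_uniq_mem // (sorted_uniq ltn_trans ltnn) ?elts_sorted.
rewrite addnC -count_predUI [X in _ = _ + X](eq_count (a2 := pred0)); last first.
  by move=> i /=; lia.
by rewrite count_pred0 addn0; apply: eq_count => i /=; lia.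
Qed.

Lemma v_mono x i j : i <= j -> v x j <= v x i.
Proof.
move/subnK <-; elim: (j - i) => // d IH.
by apply: leq_trans IH; rewrite addSn [X in _ <= X]v_step; lia.
Qed.

Lemma v_inj x y : (forall m, m < n -> v x m.+1 = v y m.+1) -> x = y.
Proof.
move=> exy; have {}exy m : v x m = v y m.
  case: m => [|m]; first by rewrite !v0.
  by case: (ltnP m n) => mn; [exact: exy | rewrite !v_gt].
apply: val_inj; apply/setP => i /=; rewrite -!mem_elts.
have := exy i; rewrite v_step [RHS]v_step exy.
by case: (_ \in _); case: (_ \in _) => //; lia.
Qed.

(** The states built in the proof (meets, medians, splices, single moves) have
    an evident counting function but no evident list of elements. A function
    falling from [k] to 0 by steps of at most 1 counts the set of its
    descents. *)
Lemma istate_of_v (g : nat -> nat) : g 0 = k -> g n.+1 = 0 ->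
    (forall j, j <= n -> g j.+1 <= g j <= (g j.+1).+1) ->
  exists x, forall j, j <= n.+1 -> v x j = g j.
Proof.
move=> g0 gn gs; pose s := [set i : 'I_n.+1 | g i != g i.+1].
have cs d : d <= n.+1 -> #|[set i in s | n.+1 - d <= i]| = g (n.+1 - d).
  elim: d => [_|d IH dn].
    by rewrite subn0 gn; apply: eq_card0 => i; rewrite !inE leqNgt ltn_ord andbF.
  have ltd : n.+1 - d.+1 < n.+1 by lia.
  pose i0 := Ordinal ltd.
  rewrite (cardsD1 i0) !inE leqnn andbT.
  rewrite (_ : _ :\ _ = [set i in s | n.+1 - d <= i]); last first.
    apply/setP => i; rewrite !inE -val_eqE /=.
    by case: (g i == _) => //=; rewrite ?andbF //; lia.
  rewrite IH; last lia.
  have -> : n.+1 - d = i0.+1 by rewrite /=; lia.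
  have /gs : val i0 <= n by rewrite -ltnS ltn_ord.
  by rewrite /=; case: eqP; lia.
have ck : #|s| == k.
  rewrite -g0 -(subnn n.+1) -cs //; apply/eqP; apply: eq_card => i.
  by rewrite !inE subnn leq0n andbT.
exists (IState ck) => j jn; rewrite /v /=.
by have := cs (n.+1 - j); rewrite (_ : n.+1 - (_ - j) = j); [apply|]; lia.
Qed.

Lemma sorted_nth_count (s : seq nat) i m : sorted ltn s -> i < size s ->
  (m <= nth 0 s i) = (size s - i <= count (leq m) s).
Proof.
elim: s i => //= a s IH i pas ilt.
have all_ge : m <= a -> count (leq m) s = size s.
  move=> ma; apply/eqP; rewrite -all_count; apply/allP => b bs.
  apply: leq_trans ma (ltnW _).
  by move: bs; apply: (allP (order_path_min ltn_trans pas)).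
case: i ilt => [_|i ilt] /=.
  by have [/all_ge->|_] := leqP m a; have := count_size (leq m) s; lia.
rewrite subSS IH ?(path_sorted pas) //.
by have [/all_ge->|_] := leqP m a; lia.
Qed.

(** [el x i] has [k - i] elements at or above it, itself included; this is the
    bridge from elements to counting functions. *)
Lemma el_v x i m : i < k -> (m <= el x i) = (k - i <= v x m).
Proof.
by move=> ik; rewrite /el sorted_nth_count ?elts_sorted ?size_elts ?v_count.
Qed.

(** The elements and the counting function of a state are inverse monotone
    functions, so comparing the former amounts to comparing the latter. *)
Lemma el_le_v x y d :
  (forall i, i < k -> el x i <= el y i + d) <-> (forall m, v x (m + d) <= v y m).
Proof.
split=> H.
  move=> m; have [/eqP->//|] := boolP (v x (m + d) == 0); rewrite -lt0n => vp.
  have vk : v x (m + d) <= k by have := v_mono x (leq0n (m + d)); rewrite v0.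
  have ik : k - v x (m + d) < k by lia.
  have := H _ ik; have : m + d <= el x (k - v x (m + d)) by rewrite el_v //; lia.
  move=> h1 h2; have : m <= el y (k - v x (m + d)) by lia.
  by rewrite el_v //; lia.
move=> i ik; have [dx|] := leqP d (el x i); last by lia.
rewrite addnC -leq_subLR el_v //; apply: leq_trans (H _).
by rewrite subnK // -el_v.
Qed.

Lemma ist_ge_v z x : reflect (forall m, v z m <= v x m) (ist_ge z x).
Proof.
apply: (iffP forallP) => H.
  move=> m; rewrite -[m in v z m]addn0; apply: (el_le_v z x 0).1 => i ik.
  by rewrite addn0; exact: (H (Ordinal ik)).
by move=> i; rewrite -[el x i]addn0; apply: (el_le_v z x 0).2 => // m; rewrite addn0.
Qed.

Lemma not_far_v x y :
  reflect (forall m, v x m.+1 <= v y m /\ v y m.+1 <= v x m) (not_far x y).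
Proof.
have absP (a b : nat) : (`|a%:Z - b%:Z| <= 1)%R = (a <= b + 1) && (b <= a + 1) by lia.
apply: (iffP forallP) => H.
  have Hn i : i < k -> el x i <= el y i + 1 /\ el y i <= el x i + 1.
    by move=> ik; have := H (Ordinal ik); rewrite absP => /andP[].
  move=> m; rewrite -addn1.
  by split; apply: (el_le_v _ _ 1).1 => i /Hn [].
move=> i; rewrite absP; apply/andP.
by split; apply: (el_le_v _ _ 1).2 => // m; rewrite addn1; case: (H m).
Qed.

Lemma left_istE x : left_ist x = (v x n == 0).
Proof.
rewrite /left_ist -mem_elts /= v_step (v_gt x (ltnSn n)) addn0.
by case: (_ \in _).
Qed.

End States.

(** * Covering and evaluation *)

Lemma mpoly_ring_ind (R : comNzRingType) (n : nat) (Q : {mpoly R[n]} -> Prop) :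
    (forall c, Q c%:MP) -> (forall i, Q 'X_i) ->
    (forall p q, Q p -> Q q -> Q (p + q)) -> (forall p q, Q p -> Q q -> Q (p * q)) ->
  forall p, Q p.
Proof.
move=> QC QX QD QM.
have Q1 : Q 1 by rewrite -mpolyC1.
apply: mpolyind => [|c m p _ _ Qp]; first by rewrite -mpolyC0.
apply: (QD) => //; rewrite -mul_mpolyC mpolyXE_id; apply: (QM) => //.
refine (big_ind Q Q1 QM _) => i _.
by elim: (m i) => [|d IH]; rewrite ?expr0 // exprS; apply: QM.
Qed.

Section Covering.
Local Open Scope nat_scope.
Variables n k : nat.
Local Notation V := (istate n k).
Implicit Types x y z w : V.

(** In terms of elements: z_i <= x_i <= z_i + 1 for all i. For a left state [z],
    in terms of the path on the vertices 0, ..., n: once the edges from m to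
    m + 1 with m outside [z] are cut, [x] misses exactly one vertex of each
    component. *)
Definition covers z x : Prop := forall m, v z m.+1 <= v x m.+1 <= v z m.

Lemma coversP z x : reflect (covers z x) (not_far x z && ist_ge z x).
Proof.
apply: (iffP andP) => [[/not_far_v nf /ist_ge_v ge] m|c].
  by rewrite ge; case: (nf m).
split.
  by apply/not_far_v => m; have := c m; have := v_step x m; have := v_step z m; lia.
by apply/ist_ge_v => -[|m]; rewrite ?v0 //; case/andP: (c m).
Qed.

Lemma covers_hole z x m : covers z x -> m \notin elts z -> v x m.+1 = v z m.+1.
Proof. by move=> /(_ m) + /negPf mz; have := v_step z m; rewrite mz; lia. Qed.

(** Where [z] has no hole, [v z] falls at full speed to the right, so a function
    that agrees with it at the holes is squeezed on either side of them. *)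
Lemma covers_of_holes z x :
  (forall m, m < n -> m \notin elts z -> v x m.+1 = v z m.+1) -> covers z x.
Proof.
move=> H; have {}H m : m \notin elts z -> v x m.+1 = v z m.+1.
  by case: (ltnP m n) => [|mn _]; [exact: H | rewrite !v_gt].
have lo m : v z m <= v x m.
  elim: m => [|m IH]; first by rewrite !v0.
  have [mz|/H-> //] := boolP (m \in elts z).
  by have := v_step z m; have := v_step x m; rewrite mz; lia.
suff hi d m : n <= m + d -> v x m.+1 <= v z m by move=> m; rewrite lo (hi n) ?leq_addl.
elim: d m => [|d IH] m nm; first by rewrite v_gt // ltnS -[m]addn0.
have := IH m.+1; rewrite addSnnS => /(_ nm) vm.
have [mz|/H->] := boolP (m \in elts z); last exact: v_mono.
by have := v_step z m; have := v_step x m.+1; rewrite mz; lia.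
Qed.

End Covering.

Section Specialization.
Variables n k : nat.
Local Notation V := (istate n k).
Local Notation ZU := {mpoly int[n]}.
Local Notation ZY := {mpoly int[k]}.
Implicit Types x y z w : V.

(** The quotient of Z[U] by the variables U_(m+1) with m outside [z] is a
    polynomial ring in k variables; [extend z] is the section of the quotient
    map that puts back the names of the surviving variables. *)
Definition restrict z (p : ZU) : ZY :=
  p \mPo [tuple \sum_(i < k | el z i == m) 'X_i | m < n].

HB.instance Definition _ z := GRing.isZmodMorphism.Build ZU ZY (restrict z)
  (raddfB (comp_mpoly [tuple \sum_(i < k | el z i == m) 'X_i | m < n])).
HB.instance Definition _ z := GRing.isMonoidMorphism.Build ZU ZY (restrict z)
  (rmorphism_monoidP (comp_mpoly [tuple \sum_(i < k | el z i == m) 'X_i | m < n])).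

Definition extend z (q : ZY) : ZU := q \mPo [tuple U n (el z i).+1 | i < k].

HB.instance Definition _ z := GRing.isZmodMorphism.Build ZY ZU (extend z)
  (raddfB (comp_mpoly [tuple U n (el z i).+1 | i < k])).
HB.instance Definition _ z := GRing.isMonoidMorphism.Build ZY ZU (extend z)
  (rmorphism_monoidP (comp_mpoly [tuple U n (el z i).+1 | i < k])).

Lemma el_elts z (i : 'I_k) : el z i \in elts z.
Proof. by rewrite /el mem_nth ?size_elts. Qed.

Lemma el_surj z m : m \in elts z -> exists i : 'I_k, el z i = m.
Proof.
move=> mz; have ik : (index m (elts z) < k)%N.
  by rewrite -[X in (_ < X)%N](size_elts z) index_mem.
by exists (Ordinal ik); rewrite /el nth_index.
Qed.

Lemma el_inj z (i j : 'I_k) : el z i = el z j -> i = j.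
Proof.
move=> /eqP; rewrite /el nth_uniq ?size_elts //; first by move/eqP/val_inj.
by rewrite (sorted_uniq ltn_trans ltnn) ?elts_sorted.
Qed.

Lemma restrictX z (m : 'I_n) : restrict z 'X_m = \sum_(i < k | el z i == m) 'X_i.
Proof. by rewrite /restrict comp_mpolyXU -tnth_nth tnth_mktuple. Qed.

Lemma restrict_hole z (m : 'I_n) : nat_of_ord m \notin elts z -> restrict z 'X_m = 0.
Proof.
by move=> mz; rewrite restrictX big1 // => i /eqP ei; rewrite -ei el_elts in mz.
Qed.

Lemma restrict_el z (i : 'I_k) (m : 'I_n) : el z i = m -> restrict z 'X_m = 'X_i.
Proof.
move=> im; rewrite restrictX (big_pred1 i) // => j.
by rewrite -im; apply/eqP/eqP => [/el_inj|->].
Qed.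

Lemma U_ord (m : 'I_n) : U n m.+1 = 'X_m.
Proof. by rewrite /U (big_pred1 m) // => i; rewrite eqSS eq_sym. Qed.

Lemma prod_U_nat (a b : nat) : (b <= n)%N ->
  \prod_(a <= t < b) U n t.+1 = \prod_(s < n) ('X_s : ZU) ^+ (a <= s < b)%N.
Proof.
move=> bn; rewrite (big_nat_widenl _ 0) // (big_nat_widen _ _ n) //.
rewrite big_mkord big_mkcond; apply: eq_bigr => s _; rewrite U_ord andbC /=.
by case: (_ && _); rewrite ?expr1 ?expr0.
Qed.

Lemma prodX_mulX (e : 'I_n -> nat) (m : 'I_n) :
  (\prod_(s < n) ('X_s : ZU) ^+ e s) * 'X_m = \prod_(s < n) 'X_s ^+ (e s + (s == m)).
Proof.
rewrite (bigD1 m) // [RHS](bigD1 m) //= eqxx exprD expr1 -!mulrA; congr (_ * _).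
by rewrite mulrC; congr (_ * _); apply: eq_bigr => s /negPf->; rewrite addn0.
Qed.

Lemma extendX z (i : 'I_k) : extend z 'X_i = U n (el z i).+1.
Proof. by rewrite /extend comp_mpolyXU -tnth_nth tnth_mktuple. Qed.

Lemma left_el z (i : nat) : left_ist z -> (i < k)%N -> (el z i < n)%N.
Proof. by rewrite left_istE => zn ik; rewrite ltnNge el_v // (eqP zn); lia. Qed.

Lemma restrictK z : left_ist z -> cancel (extend z) (restrict z).
Proof.
move=> lz q; elim/mpoly_ring_ind: q => [c|i|p q IHp IHq|p q IHp IHq].
- by rewrite /extend /restrict !comp_mpolyC.
- have mn := left_el lz (ltn_ord i).
  by rewrite extendX (U_ord (Ordinal mn)); apply: restrict_el.
- by rewrite !rmorphD /= IHp IHq.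
- by rewrite !rmorphM /= IHp IHq.
Qed.

Lemma extend_restrict z (p : ZU) : exists q : 'I_n -> ZU,
  p = extend z (restrict z p) + \sum_(m < n | nat_of_ord m \notin elts z) 'X_m * q m.
Proof.
elim/mpoly_ring_ind: p => [c|i|p1 p2 [q1 e1] [q2 e2]|p1 p2 [q1 e1] [q2 e2]].
- exists (fun _ => 0); rewrite /extend /restrict !comp_mpolyC big1 ?addr0 // => m _.
  by rewrite mulr0.
- have [iz|iz] := boolP (nat_of_ord i \in elts z); last first.
    exists (fun m => (m == i)%:R); rewrite restrict_hole // rmorph0 add0r.
    rewrite (bigD1 i) //= eqxx mulr1 big1 ?addr0 // => m /andP[_ /negPf->].
    by rewrite mulr0.
  exists (fun _ => 0); rewrite big1 ?addr0 => [|m _]; last by rewrite mulr0.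
  have [j ej] := el_surj iz.
  by rewrite (restrict_el ej) extendX ej U_ord.
- exists (fun m => q1 m + q2 m); rewrite {1}e1 {1}e2 !rmorphD /=.
  under [in RHS]eq_bigr => m _ do rewrite mulrDr.
  by rewrite big_split /=; ring.
- set r1 := \sum_(m < n | _) _ in e1; set r2 := \sum_(m < n | _) _ in e2.
  exists (fun m => q1 m * p2 + extend z (restrict z p1) * q2 m).
  have -> : \sum_(m < n | nat_of_ord m \notin elts z)
      'X_m * (q1 m * p2 + extend z (restrict z p1) * q2 m) =
      r1 * p2 + extend z (restrict z p1) * r2.
    rewrite mulr_suml mulr_sumr -big_split; apply: eq_bigr => m _ /=; ring.
  by rewrite !rmorphM /= {1}e1 [in LHS]mulrDl [in X in X + _]e2; ring.
Qed.

(** A product of distinct variables survives exactly when all its indices lie in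
    [z]. *)
Lemma restrict_mesym z j : left_ist z -> restrict z (mesym n int j) = mesym k int j.
Proof.
move=> lz; pose g (i : 'I_k) : 'I_n := Ordinal (left_el lz (ltn_ord i)).
have g_inj : injective g by move=> a b /(congr1 val) /= /el_inj.
have restrict_g i : restrict z 'X_(g i) = 'X_i by apply: restrict_el.
rewrite /mesym rmorph_sum (bigID (fun h : {set 'I_n} => h \subset g @: setT)) /=.
rewrite [X in _ + X]big1 ?addr0 => [|h /andP[_ /subsetPn[m mh mz]]]; last first.
  rewrite rmorph_prod (bigD1 m) //= restrict_hole ?mul0r //.
  apply: contra mz => mz; apply/imsetP.
  by have [i ei] := el_surj mz; exists i => //; apply: val_inj.
rewrite (reindex_onto (fun h : {set 'I_k} => g @: h) (fun h => g @^-1: h)) /=; last first.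
  move=> h /andP[_ /subsetP hg]; apply/setP => m; apply/imsetP/idP => [[i + ->]|mh].
    by rewrite inE.
  by have /imsetP[i _ mi] := hg m mh; exists i => //; rewrite inE -mi.
apply: eq_big => [h|h _].
  rewrite card_imset // imsetS ?subsetT // andbT.
  have -> : g @^-1: (g @: h) = h by apply/setP => i; rewrite inE mem_imset.
  by rewrite eqxx andbT.
rewrite rmorph_prod big_imset /=; last by move=> a b _ _ /g_inj.
by apply: eq_bigr => i _; apply: restrict_g.
Qed.

Lemma restrict_eps z c : left_ist z ->
  restrict z (eps_act n c) = c \mPo [tuple mesym k int i.+1 | i < k].
Proof.
move=> lz; elim/mpoly_ring_ind: c => [c|i|p q IHp IHq|p q IHp IHq].
- by rewrite /eps_act /restrict !comp_mpolyC.
- by rewrite /eps_act !comp_mpolyXU -!tnth_nth !tnth_mktuple restrict_mesym.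
- by rewrite /eps_act !rmorphD /= -IHp -IHq.
- by rewrite /eps_act !rmorphM /= -IHp -IHq.
Qed.

End Specialization.

(** * The ideal of relations is not too large *)

Section Relations.
Variables n k : nat.
Local Notation V := (istate n k).
Local Notation ZU := {mpoly int[n]}.
Local Notation ZY := {mpoly int[k]}.
Implicit Types x y z w : V.

(** One element of [x] crosses line i + 1 from left to right. *)
Definition moves (i : 'I_n) x y : Prop :=
  forall m, v y m = (v x m + (m == i.+1))%N.

Lemma moves_mem (i : 'I_n) x y : moves i x y ->
  [/\ nat_of_ord i \in elts x, i.+1 \notin elts x, nat_of_ord i \notin elts y
    & i.+1 \in elts y].
Proof.
move=> xy.
have e0 : v y i = v x i by rewrite xy (_ : (_ == _) = false) ?addn0 //; lia.
have e1 : v y i.+1 = (v x i.+1).+1 by rewrite xy eqxx addn1.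
have e2 : v y i.+2 = v x i.+2 by rewrite xy (_ : (_ == _) = false) ?addn0 //; lia.
have := v_step x i; have := v_step x i.+1; have := v_step y i; have := v_step y i.+1.
rewrite e0 e1 e2.
by do 4 case: (_ \in _); split=> //; lia.
Qed.

Lemma lreg_neq_rreg (i : 'I_n) : lreg i != rreg i.
Proof. by rewrite -val_eqE /= /bump /=; lia. Qed.

Lemma moves_sets (i : 'I_n) x y :
  reflect (moves i x y)
    (((x : {set _}) :&: [set lreg i; rreg i] == [set lreg i]) &&
      ((y : {set _}) == (x :\ lreg i) :|: [set rreg i])).
Proof.
apply: (iffP andP) => [[/eqP xi /eqP yE] m|xy].
  have lx : lreg i \in (x : {set _}).
    by have /setP/(_ (lreg i)) := xi; rewrite !inE eqxx andbT.
  have rx : rreg i \notin (x : {set _}).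
    have /setP/(_ (rreg i)) := xi; rewrite !inE eqxx orbT andbT => ->.
    by rewrite eq_sym lreg_neq_rreg.
  have {}lx : nat_of_ord i \in elts x.
    by rewrite -[nat_of_ord i]/(val (lreg i)) mem_elts.
  have {}rx : i.+1 \notin elts x by rewrite -[i.+1]/(val (rreg i)) mem_elts.
  have mem j : (j <= n)%N ->
      (j \in elts y) = (j == i.+1) || (j \in elts x) && (j != i).
    rewrite -ltnS => jn; rewrite -[j]/(val (Ordinal jn)) !mem_elts yE !inE.
    by rewrite -!val_eqE /= /bump /= add1n orbC andbC.
  have [|mn] := leqP m n.+1; last first.
    by rewrite !v_gt; [have := ltn_ord i; lia | lia..].
  move/subKn <-; elim: (n.+1 - m)%N => [|d IH].
    by rewrite subn0 !v_gt //; have := ltn_ord i; lia.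
  have [dn|dn] := leqP d n; last first.
    by move: IH; rewrite (_ : n.+1 - d = n.+1 - d.+1)%N //; lia.
  set M := (n.+1 - d.+1)%N; have Mn : (M <= n)%N by lia.
  rewrite (_ : (n.+1 - d = M.+1)%N) in IH; last by lia.
  rewrite v_step [v x M]v_step IH (mem _ Mn) eqSS.
  have [->|d1] := eqVneq M i.+1; first by rewrite (negPf rx); lia.
  by have [->|d2] := eqVneq M i; rewrite ?lx /=; lia.
have [ix i1x iy i1y] := moves_mem xy; split; apply/eqP/setP => j.
  rewrite !inE; have [->|jl] := eqVneq j (lreg i).
    by rewrite andbT -mem_elts.
  have [->|jr] := eqVneq j (rreg i); last by rewrite andbF.
  by rewrite andbT -mem_elts; apply/negbTE.
rewrite !inE; have [->|jl] := eqVneq j (lreg i).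
  by rewrite /= (negPf (lreg_neq_rreg i)) -mem_elts; apply/negbTE.
have [->|jr] := eqVneq j (rreg i); first by rewrite orbT -mem_elts.
rewrite orbF /= -!mem_elts.
have := v_step y j; rewrite xy xy (v_step x j).
have -> : (nat_of_ord j == i.+1) = false.
  by apply: contraNF jr => /eqP ji; apply/eqP/val_inj.
have -> : (j.+1 == i.+1) = false.
  by rewrite eqSS; apply: contraNF jl => /eqP ji; apply/eqP/val_inj.
by rewrite /=; case: (_ \in elts y); case: (_ \in elts x) => //=; lia.
Qed.

Lemma coef_sum_f (C : pred (V * V)) x y :
  coef (\sum_(p : V * V | C p) f p.1 p.2) x y = (C (x, y))%:R.
Proof.
rewrite Defs.coef_sum; have [Cxy|Cxy] := boolP (C (x, y)).
  rewrite (bigD1 (x, y)) //= coef_f !eqxx big1 ?addr0 // => -[a b] /andP[_ ab].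
  by rewrite coef_f; move: ab; rewrite xpair_eqE eq_sym [b == _]eq_sym => /negPf->.
rewrite big1 // => -[a b] Cab; rewrite coef_f.
by case: andP => // -[/eqP xa /eqP yb]; rewrite xa yb Cab in Cxy.
Qed.

Lemma coef_Rgen i x y : coef (Rgen k i) x y = `[< moves i x y >]%:R.
Proof.
rewrite /Rgen coef_sum_f /=; congr (nat_of_bool _)%:R.
by apply/moves_sets/asboolP.
Qed.

Lemma coef_Lgen i x y : coef (Lgen k i) x y = `[< moves i y x >]%:R.
Proof.
rewrite /Lgen coef_sum_f /=; congr (nat_of_bool _)%:R.
have <- : ((y : {set _}) :&: [set lreg i; rreg i] == [set lreg i]) &&
    ((x : {set _}) == (y :\ lreg i) :|: [set rreg i]) = `[< moves i y x >].
  by apply/moves_sets/asboolP.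
have lr := lreg_neq_rreg i.
apply/andP/andP => -[/eqP xi /eqP yE].
  have rx : rreg i \in (x : {set _}).
    by have /setP/(_ (rreg i)) := xi; rewrite !inE eqxx orbT andbT.
  have lx : lreg i \notin (x : {set _}).
    by have /setP/(_ (lreg i)) := xi; rewrite !inE eqxx /= andbT => ->.
  split; apply/eqP/setP => j; rewrite yE !inE.
    have [->|jl] := eqVneq j (lreg i); first by rewrite orbT.
    by have [->|jr] := eqVneq j (rreg i); rewrite ?orbF ?andbF.
  have [->|jl] := eqVneq j (lreg i); first by rewrite (negPf lr) (negPf lx).
  by have [->|jr] := eqVneq j (rreg i); rewrite ?orbF ?orbT ?rx.
have ly : lreg i \in (y : {set _}).
  by have /setP/(_ (lreg i)) := xi; rewrite !inE eqxx andbT.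
have ry : rreg i \notin (y : {set _}).
  have /setP/(_ (rreg i)) := xi; rewrite !inE eqxx orbT andbT => ->.
  by rewrite eq_sym.
split; apply/eqP/setP => j; rewrite yE !inE.
  have [->|jl] := eqVneq j (lreg i); first by rewrite /= (negPf lr).
  by have [->|jr] := eqVneq j (rreg i); rewrite ?orbF ?andbF ?orbT.
have [->|jl] := eqVneq j (lreg i); first by rewrite orbT ly.
by have [->|jr] := eqVneq j (rreg i); rewrite ?orbF ?(negPf ry).
Qed.

(** Crossing two lines in a row moves an element by two, but two states covered
    by [z] have their i-th elements in {z_i, z_i + 1}. *)
Lemma covers_moves2 z x y w (i j : 'I_n) : j = i.+1 :> nat ->
  covers z x -> covers z y -> moves i x w -> moves j w y -> False.
Proof.
move=> ji zx zy xw wy.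
have [_ i1x _ i1w] := moves_mem xw.
have := xw i.+2; have := wy i.+2; have := v_step x i.+1; rewrite ji eqxx (negPf i1x).
by have := zx i; have := zy i.+1; lia.
Qed.

(** A product of two basis elements from one covered state to another through a
    state that [z] does not cover has in its structure constant a variable sent
    to zero; hence the matrices indexed by the covered states only, with
    coefficients in Z[U] restricted to [z], still multiply correctly, and
    vanishing on them passes to the ideal generated by the relations. *)
Lemma gen_ideal_restrict (a : B0 n k) : gen_ideal (@B_rel n k) a ->
  forall z x y, covers z x -> covers z y -> restrict z (coef a x y) = 0.
Proof.
have Ug0 z x w y : covers z x -> covers z y -> ~ covers z w ->
    restrict z (Ug x w y) = 0.
  move=> zx zy; apply: contra_notP => /eqP Unz; apply: covers_of_holes => m mn mz.
  apply/eqP; apply: contraNT Unz => vm.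
  rewrite /Ug rmorph_prod (bigD1 (Ordinal mn)) //=.
  have g0 : gexp x w y m.+1 != 0%N.
    have := covers_hole zx mz; have := covers_hole zy mz; move/eqP: vm.
    by rewrite /gexp /vdist; lia.
  by rewrite rmorphXn /= restrict_hole // expr0n (negPf g0) mul0r.
elim=> {a} [_ [i j ji|i j ji|i x0 xi]||a b _ IHa _ IHb|r a _ IHa|r a _ IHa] z x y zx zy.
- rewrite Defs.coefM rmorph_sum big1 // => w _; rewrite !coef_Rgen.
  case: asboolP => [xw|]; last by rewrite mulr0 mul0r rmorph0.
  case: asboolP => [wy|]; last by rewrite mulr0 rmorph0.
  by case: (covers_moves2 ji zx zy xw wy).
- rewrite Defs.coefM rmorph_sum big1 // => w _; rewrite !coef_Lgen.
  case: asboolP => [xw|]; last by rewrite mulr0 mul0r rmorph0.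
  case: asboolP => [wy|]; last by rewrite mulr0 rmorph0.
  by case: (covers_moves2 ji zy zx wy xw).
- rewrite Defs.coefZ rmorphM coef_f /=.
  case: andP => [[/eqP xx _]|]; last by rewrite rmorph0 mulr0.
  rewrite restrict_hole ?mul0r //; subst x0.
  have /setP xi' := xi.
  have := xi' (lreg i); have := xi' (rreg i); rewrite !inE !eqxx orbT !andbT -!mem_elts.
  rewrite [val (rreg i)]/= /bump add1n => rx lx.
  have := v_step x i; have := v_step x i.+1; rewrite rx lx.
  have : (v z i <= v x i)%N.
    by case: (nat_of_ord i) => [|m]; [rewrite !v0 | case/andP: (zx m)].
  by have := zx i.+1; have := v_step z i; case: (_ \in _) => //; lia.
- by rewrite Defs.coef0 rmorph0.
- rewrite -scaleN1r Defs.coefD Defs.coefZ rmorphD rmorphM /=.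
  by rewrite IHa // IHb // mulr0 addr0.
- rewrite Defs.coefM rmorph_sum big1 // => w _; rewrite !rmorphM /=.
  have [zw|zw] := pselect (covers z w); first by rewrite IHa // mulr0.
  by rewrite Ug0 // !mul0r.
- rewrite Defs.coefM rmorph_sum big1 // => w _; rewrite !rmorphM /=.
  have [zw|zw] := pselect (covers z w); first by rewrite IHa // mulr0 mul0r.
  by rewrite Ug0 // !mul0r.
Qed.

End Relations.

(** * The ideal of relations is not too small *)

Section LowerBound.
Variables n k : nat.
Local Notation V := (istate n k).
Local Notation ZU := {mpoly int[n]}.
Implicit Types x y z w : V.
Local Notation I := (gen_ideal (@B_rel n k)).

Lemma idealZ c a : I a -> I (c *: a).
Proof. by move=> Ia; rewrite -[a]mul1r B0_scaleAl; apply: gen_idealMl. Qed.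

(** No line is crossed back and forth on the way from [x] to [y] through [w], so
    that f_(x,w) f_(w,y) = f_(x,y). *)
Definition between x w y : Prop :=
  forall m, vdist x y m = (vdist x w m + vdist w y m)%N.

Lemma Ug_between x w y : between x w y -> Ug x w y = 1.
Proof.
by move=> b; rewrite /Ug big1 // => i _; rewrite /gexp b addnC subnn expr0.
Qed.

Lemma fM_between x w y : between x w y -> f x w * f w y = f x y.
Proof. by move=> b; rewrite fM eqxx Ug_between ?scale1r. Qed.

Lemma ideal_widen_r p x w y : between x w y -> I (p *: f x w) -> I (p *: f x y).
Proof. by move=> /fM_between <- Ip; rewrite B0_scaleAl; apply: gen_idealMr. Qed.

Lemma ideal_widen_l p x w y : between x w y -> I (p *: f w y) -> I (p *: f x y).
Proof. by move=> /fM_between <- Ip; rewrite B0_scaleAr; apply: gen_idealMl. Qed.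

Lemma corner_f (a : B0 n k) x y : f x x * a * f y y = coef a x y *: f x y.
Proof.
apply: coefP => s t; rewrite Defs.coefM (bigD1 y) //= big1 => [|w wy]; last first.
  by rewrite coef_f (negPf wy) mulr0.
rewrite Defs.coefM (bigD1 x) //= big1 => [|w wx]; last first.
  by rewrite coef_f (negPf wx) andbF mulr0 mul0r.
rewrite Defs.coefZ !coef_f !eqxx andbT /= !addr0.
have [->|_] := eqVneq s x; last by rewrite !(mulr0, mul0r).
have [->|_] := eqVneq t y; last by rewrite !(mulr0, mul0r).
by rewrite Ugl Ugr !mulr1 !mul1r.
Qed.

Lemma moves_exist (i : 'I_n) x : nat_of_ord i \in elts x -> i.+1 \notin elts x ->
  exists y, moves i x y.
Proof.
move=> ix i1x; have il := ltn_ord i.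
have [||j jn|y vy] := @istate_of_v n k (fun m => v x m + (m == i.+1))%N.
- by rewrite v0 addn0.
- by rewrite v_gt // eqn_leq [(_ <= i.+1)%N]leqNgt ltnS il.
- have := v_step x j; have [ji|ji] := eqVneq j i.+1.
    by rewrite ji (negPf i1x) (_ : (i.+2 == i.+1) = false); lia.
  have [{}ji|{}ji] := eqVneq j.+1 i.+1; last by case: (_ \in _); lia.
  by case: ji => ->; rewrite ix; lia.
exists y => m; have [mn|mn] := leqP m n.+1; first exact: vy.
by rewrite !v_gt; lia.
Qed.

Lemma moves_between (i j : 'I_n) x w y : j = i.+1 :> nat ->
  moves i x w -> moves j w y -> between x w y /\ between y w x.
Proof. by move=> ji xw wy; split=> m; rewrite /vdist !wy !xw; lia. Qed.

(** The product of two consecutive R's or L's has a single term from [x] to [y],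
    the one through [w], and its structure constant is 1. *)
Lemma ideal_far_move (i j : 'I_n) x w y : j = i.+1 :> nat ->
  moves i x w -> moves j w y -> I (f x y) /\ I (f y x).
Proof.
move=> ji xw wy; have [b b'] := moves_between ji xw wy.
have uniq u : (forall m, v u m = v w m) -> u = w by move=> uw; apply: v_inj.
split.
  rewrite -[f x y]scale1r.
  have <- : coef (Rgen k i * Rgen k j) x y = 1.
    rewrite Defs.coefM (bigD1 w) //= big1 ?addr0 => [|u uw]; rewrite !coef_Rgen.
      by rewrite !asboolT // !mulr1 Ug_between.
    case: asboolP => [xu|]; last by rewrite mulr0 mul0r.
    by rewrite (uniq u) ?eqxx // in uw; move=> m; rewrite xw xu.
  by rewrite -corner_f; apply/gen_idealMr/gen_idealMl/gen_ideal_in/B_rel_RR.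
rewrite -[f y x]scale1r.
have <- : coef (Lgen k j * Lgen k i) y x = 1.
  rewrite Defs.coefM (bigD1 w) //= big1 ?addr0 => [|u uw]; rewrite !coef_Lgen.
    by rewrite !asboolT // !mulr1 Ug_between.
  case: (asboolP (moves i x u)) => [xu|]; last by rewrite mulr0.
  by rewrite (uniq u) ?eqxx // in uw; move=> m; rewrite xw xu.
by rewrite -corner_f; apply/gen_idealMr/gen_idealMl/gen_ideal_in/B_rel_LL.
Qed.

(** Between two states that are too far lie two states [w] and [a] that differ by
    one element jumping over two lines. The state [w] is the pointwise median of
    [v x], [v y] and the constant [q], the level at which [x] and [y] are too
    far: it takes the larger of the two functions below this level and the
    smaller one above, so it leaves room for the jump to [a] while [a] and [w]
    stay between [x] and [y]. *)
Lemma ideal_too_far x y m : (v y m < v x m.+1)%N -> I (f x y) /\ I (f y x).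
Proof.
move=> far.
(* At the least such m, [v y] drops between m - 1 and m, so that the element to
   be moved starts right there. *)
have [m' {}far min] := ex_minnP (ex_intro (fun m => v y m < v x m.+1)%N m far).
move: m' => [|i] in far min *.
  by have := v_mono x (leq0n 1); move: far; rewrite !v0; lia.
have vyi : (v x i.+1 <= v y i)%N.
  by rewrite leqNgt; apply/negP => /min; rewrite ltnn.
have xi1 := v_step x i.+1; have yi1 := v_step y i.+1; have xi2 := v_step x i.+2.
have jn : (i.+1 < n)%N.
  by rewrite ltnNge; apply/negP => jn; move: far; rewrite [v x _]v_gt.
pose q := v y i.+1.
have qk : (q <= k)%N by have := v_mono y (leq0n i.+1); rewrite v0.
pose g s := maxn (minn (v x s) (v y s)) (minn q (maxn (v x s) (v y s))).
have [||j _|w vw] := @istate_of_v n k g.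
- by rewrite /g !v0; lia.
- by rewrite /g !v_gt.
- by have := v_step x j; have := v_step y j; rewrite /g; lia.
have {}vw s : v w s = g s.
  by have [/vw //|sn] := leqP s n.+1; rewrite /g !v_gt; lia.
pose i1 : 'I_n := Ordinal (ltnW jn); pose i2 : 'I_n := Ordinal jn.
have xi0 := v_step x i; have yi2 := v_step y i.+2.
have wi : (q < v w i)%N by clear -xi0 xi1 far vyi vw; rewrite vw /g /q; lia.
have wi1 : v w i.+1 = q by clear -xi1 far vw; rewrite vw /g /q; lia.
have wi2 : v w i.+2 = q by clear -yi1 far vw; rewrite vw /g /q; lia.
have wi3 : v w i.+3 = q by clear -xi2 yi1 yi2 far vw; rewrite vw /g /q; lia.
clear xi0 xi1 xi2 yi1 yi2 vyi min.
have [] := @moves_exist i1 w.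
- by move: wi; rewrite v_step wi1; case: (_ \in _); rewrite ?ltnn.
- by have := v_step w i.+1; rewrite wi1 wi2 /=; case: (_ \in _); lia.
move=> b wb.
have [] := @moves_exist i2 b.
- by have [] := moves_mem wb.
- by have := v_step b i.+2; rewrite !wb wi2 wi3 /=; case: (_ \in _); lia.
move=> a ba.
have va s : v a s = (v w s + (s == i.+1) + (s == i.+2))%N by rewrite ba wb.
have xm := v_mono x (leqnSn i.+1); have ym := v_mono y (leqnSn i.+1).
have ne : (i.+1 == i.+2) = false by lia.
have ne' : (i.+2 == i.+1) = false by lia.
have btw : between x a y /\ between a w y.
  split=> s; rewrite /vdist va.
    have [->|s1] := eqVneq s i.+1; first by rewrite wi1 ne /q; clear -far xm; lia.
    have [->|s2] := eqVneq s i.+2; first by rewrite wi2 /q; clear -far ym; lia.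
    by rewrite vw /g; clear; lia.
  have [->|s1] := eqVneq s i.+1; first by rewrite wi1 ne /q; clear; lia.
  have [->|s2] := eqVneq s i.+2; first by rewrite wi2 /q; clear -far ym; lia.
  by clear; lia.
have btwC u u' u'' : between u u' u'' -> between u'' u' u.
  by move=> bu s; move: (bu s); rewrite /vdist; clear; lia.
have [Iwa Iaw] := ideal_far_move (erefl : i2 = i1.+1 :> nat) wb ba.
case: btw => xay awy; split.
  rewrite -[f x y]scale1r; apply: (ideal_widen_l xay).
  by apply: (ideal_widen_r awy); rewrite scale1r.
rewrite -[f y x]scale1r; apply: (ideal_widen_r (btwC _ _ _ xay)).
by apply: (ideal_widen_l (btwC _ _ _ awy)); rewrite scale1r.
Qed.

(** Moving the last element of the full block into the hole at its right shortens
    the block by one, and going there and back multiplies by the last variable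
    of the interval. *)
Lemma ideal_hole_to_hole x j l : (j + l.+1 <= n)%N ->
    j \notin elts x -> (j + l.+1)%N \notin elts x ->
    (forall t, (j < t < j + l.+1)%N -> t \in elts x) ->
  I ((\prod_(j <= t < j + l.+1) U n t.+1) *: f x x).
Proof.
elim: l x => [|l IH] x jln jx jlx full.
  rewrite addn1 in jln jlx *.
  rewrite big_nat1 (U_ord (Ordinal jln)); apply/gen_ideal_in/B_rel_UI.
  apply/setP => s; rewrite !inE; apply/negbTE/negP => /andP[sx /orP[]] /eqP sE.
    by move: sx; rewrite sE -mem_elts /= (negPf jx).
  by move: sx; rewrite sE -mem_elts; apply: (negP jlx).
have il : (j + l.+1 < n)%N by lia.
have [||y xy] := @moves_exist (Ordinal il) x.
- by apply: full; rewrite /=; lia.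
- by rewrite /= -addnS.
have [_ _ jly _] := moves_mem xy.
have memy t : (t < j + l.+1)%N -> (t \in elts y) = (t \in elts x).
  move=> tl; have := v_step x t; have := v_step y t; rewrite !xy /=.
  have -> : (t == (j + l.+1).+1) = false by lia.
  have -> : (t.+1 == (j + l.+1).+1) = false by lia.
  by case: (t \in elts x); case: (t \in elts y); lia.
have Iy : I ((\prod_(j <= t < j + l.+1) U n t.+1) *: f y y).
  apply: IH => //; [lia|by rewrite memy //; lia|].
  by move=> t tl; rewrite memy; [apply: full|]; lia.
have {1}-> : (j + l.+2 = (j + l.+1).+1)%N by lia.
rewrite big_nat_recr /=; last by lia.
have UgE : Ug x y x = U n (j + l.+1).+1.
  rewrite (U_ord (Ordinal il)) /Ug (bigD1 (Ordinal il)) //= big1 => [|t tl].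
    rewrite mulr1; have -> : gexp x y x (j + l.+1).+1 = 1%N; last by rewrite expr1.
    by rewrite /gexp /vdist !xy eqxx; clear; lia.
  have tj : (t.+1 == (j + l.+1).+1) = false.
    by apply: contraNF tl => /eqP[tj]; apply/eqP/val_inj.
  have -> : gexp x y x t.+1 = 0%N; last by rewrite expr0.
  by rewrite /gexp /vdist !xy /= tj; clear; lia.
rewrite -scalerA -UgE -[Ug x y x *: _](_ : f x y * f y x = _); last by rewrite fM eqxx.
have -> : f x y * f y x = f x y * f y y * f y x.
  by rewrite [f x y * f y y]fM eqxx Ugr scale1r.
rewrite B0_scaleAl B0_scaleAr; exact/gen_idealMr/gen_idealMl.
Qed.

(** Since [x] and [y] count the same at the lines of the interval, they can be
    exchanged to the left and to the right of it; choosing on each side the one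
    that has a hole at the end of the interval gives a state between [x] and [y]
    to which [ideal_hole_to_hole] applies. *)
Lemma ideal_interval x y j l : (0 < l)%N -> (j + l <= n)%N ->
    ~~ fully_used x y j -> ~~ fully_used x y (j + l) ->
    (forall t, (j < t < j + l)%N -> fully_used x y t) ->
    (forall t, (j < t <= j + l)%N -> v x t = v y t) ->
  I ((\prod_(j <= t < j + l) U n t.+1) *: f x y).
Proof.
case: l => // l _ jln hj hl full unc.
pose a := if j \in elts x then y else x.
pose b := if (j + l.+1)%N \in elts x then y else x.
have ja : j \notin elts a.
  by move: hj; rewrite /fully_used /a; case: ifP => // /negbT.
have jb : (j + l.+1)%N \notin elts b.
  by move: hl; rewrite /fully_used /b; case: ifP => // /negbT.
have fb t : (j < t < j + l.+1)%N -> t \in elts b.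
  by move=> /full/andP[tx ty]; rewrite /b; case: ifP.
have ab : v a j.+1 = v b j.+1.
  by rewrite /a /b; do 2 case: ifP => _ //; rewrite unc //; lia.
pose g s := if (s <= j)%N then v a s else v b s.
have gS s : (s <= j)%N -> g s.+1 = v a s.+1.
  by rewrite /g; case: ltnP => // js sj; rewrite (_ : s = j) //; lia.
have g_gt s : (j < s)%N -> g s = v b s by rewrite /g; case: ltnP.
have [||s sn|w vw] := @istate_of_v n k g.
- by rewrite /g v0.
- by rewrite g_gt ?v_gt //; lia.
- have [sj|js] := leqP s j; first by rewrite gS // /g sj; have := v_step a s; lia.
  by rewrite (g_gt s js) (g_gt s.+1 (ltnW js)); have := v_step b s; lia.
have {}vw s : v w s = g s.
  have [/vw //|sn] := leqP s n.+1.
  by rewrite g_gt ?v_gt //; lia.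
have wa s : (s <= j)%N -> (s \in elts w) = (s \in elts a).
  move=> sj; have := v_step w s; have := v_step a s; rewrite !vw gS // /g sj.
  by case: (s \in elts w); case: (s \in elts a); lia.
have wb s : (j < s)%N -> (s \in elts w) = (s \in elts b).
  move=> js; have := v_step w s; have := v_step b s.
  rewrite !vw (g_gt s js) (g_gt s.+1 (ltnW js)).
  by case: (s \in elts w); case: (s \in elts b); lia.
have xwy : between x w y.
  move=> s; rewrite /vdist vw /g /a /b.
  by case: (s <= j)%N; [case: (j \in elts x)|case: (j + l.+1 \in elts x)%N];
    clear; lia.
have wwy : between w w y by move=> s; rewrite /vdist; lia.
apply: (ideal_widen_l xwy); apply: (ideal_widen_r wwy).
apply: ideal_hole_to_hole => //.
- by rewrite wa.
- by rewrite wb //; clear; lia.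
- by move=> t tj; rewrite wb ?fb //; case/andP: tj.
Qed.

End LowerBound.

(** * Artin's basis over the symmetric polynomials *)

Section ArtinTower.
Variables (P : comNzRingType) (S : P -> Prop) (k : nat) (y : nat -> P).

Definition is_subring (M : P -> Prop) : Prop :=
  [/\ M 1, forall a b, M a -> M b -> M (a - b) & forall a b, M a -> M b -> M (a * b)].

(** Stage [i] of the tower S, S[y 0], S[y 0][y 1], ..., where each stage is
    presented by the powers of the new generator below its degree [k - i] over
    the previous stage. *)
Fixpoint tower (i : nat) (p : P) : Prop :=
  if i is i'.+1 then
    exists2 a : nat -> P, forall c, tower i' (a c) &
      p = \sum_(c < k - i') a c * y i' ^+ c
  else S p.

Arguments tower : simpl never.

(** The monic polynomial that gives [y i] degree [k - i] over stage [i]. *)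
Definition tail_poly (i : nat) : {poly P} := \prod_(i <= j < k) ('X - (y j)%:P).

Hypotheses (subS : is_subring S) (coefS : forall c, S (tail_poly 0)`_c).

Section Subring.
Variable (M : P -> Prop).
Hypothesis subM : is_subring M.

Lemma subring0 : M 0.
Proof. by have [M1 MB _] := subM; rewrite -(subrr 1); apply: MB. Qed.

Lemma subringN a : M a -> M (- a).
Proof. by have [_ MB _] := subM; rewrite -sub0r; apply: MB; apply: subring0. Qed.

Lemma subringD a b : M a -> M b -> M (a + b).
Proof.
by have [_ MB _] := subM => Ma Mb; rewrite -[b]opprK; apply: MB => //; apply: subringN.
Qed.

End Subring.

Lemma tail_polyS i : (i < k)%N -> tail_poly i = ('X - (y i)%:P) * tail_poly i.+1.
Proof. by move=> ik; rewrite /tail_poly big_ltn. Qed.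

Lemma size_tail_poly i : (i <= k)%N -> size (tail_poly i) = (k - i).+1.
Proof.
by move=> ik; rewrite /tail_poly size_prod_XsubC size_iota.
Qed.

Lemma monic_tail_poly i : tail_poly i \is monic.
Proof. by apply: monic_prod_XsubC. Qed.

(** Multiplication by [y i] can raise the top power to [k - i], which
    [tail_poly i], being monic with root [y i], rewrites in lower powers. The
    coefficients of the next polynomial [tail_poly i.+1], the quotient by
    ['X - y i], come from the top down by synthetic division. *)
Lemma tower_step i : (i < k)%N -> is_subring (tower i) ->
  (forall c, tower i (tail_poly i)`_c) ->
  [/\ is_subring (tower i.+1), tower i.+1 (y i), forall p, tower i p -> tower i.+1 p
    & forall c, tower i.+1 (tail_poly i.+1)`_c].
Proof.
move=> ik subi coefi; have [M1 MB MM] := subi.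
have [d dE] : exists d, (k - i = d.+1)%N by exists (k - i).-1; lia.
have up p : tower i p -> tower i.+1 p.
  move=> Mp; exists (fun c => if c is 0%N then p else 0) => [[|c] //|].
    exact: subring0.
  by rewrite dE big_ord_recl expr0 mulr1 big1 ?addr0 // => c _; rewrite mul0r.
have TB p q : tower i.+1 p -> tower i.+1 q -> tower i.+1 (p - q).
  case=> a Ma -> [b Mb ->]; exists (fun c => a c - b c) => [c|].
    exact: MB (Ma c) (Mb c).
  by rewrite -sumrB; apply: eq_bigr => c _; rewrite mulrBl.
have TD p q : tower i.+1 p -> tower i.+1 q -> tower i.+1 (p + q).
  case=> a Ma -> [b Mb ->]; exists (fun c => a c + b c) => [c|].
    exact (subringD subi (Ma c) (Mb c)).
  by rewrite -big_split; apply: eq_bigr => c _; rewrite mulrDl.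
have T0 : tower i.+1 0 by apply: up; apply: subring0.
have TZ s p : tower i s -> tower i.+1 p -> tower i.+1 (s * p).
  move=> Ms [a Ma ->]; exists (fun c => s * a c) => [c|]; first exact: MM Ms (Ma c).
  by rewrite mulr_sumr; apply: eq_bigr => c _; rewrite mulrA.
have yd : y i ^+ d.+1 = - \sum_(c < d.+1) (tail_poly i)`_c * y i ^+ c.
  have : (tail_poly i).[y i] = 0 by rewrite tail_polyS // hornerM !hornerE subrr mul0r.
  rewrite horner_coef size_tail_poly ?(ltnW ik) // dE big_ord_recr /= => /eqP.
  have /monicP : tail_poly i \is monic by apply: monic_tail_poly.
  rewrite /lead_coef size_tail_poly ?(ltnW ik) // dE /= => ->.
  by rewrite mul1r addr_eq0 => /eqP->; rewrite opprK.
have Ty p : tower i.+1 p -> tower i.+1 (y i * p).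
  case=> a Ma ->; rewrite dE big_ord_recr /= mulrDr; apply: (TD).
    exists (fun c => if c is c'.+1 then a c' else 0) => [[|c]|].
    - exact: subring0.
    - exact: Ma.
    rewrite dE big_ord_recl /= mul0r add0r mulr_sumr.
    by apply: eq_bigr => c _ /=; rewrite exprS; ring.
  rewrite mulrCA -exprS yd mulrN -mulNr; apply: (TZ).
    exact (subringN subi (Ma d)).
  by exists (fun c => (tail_poly i)`_c) => [c|]; [exact: coefi | rewrite dE].
have TM p q : tower i.+1 p -> tower i.+1 q -> tower i.+1 (p * q).
  move=> [a Ma ->] Tq; rewrite mulr_suml; apply: (big_ind (tower i.+1)) => // c _.
  rewrite -mulrA; apply: (TZ); first exact: Ma.
  elim: (val c) => [|m IH]; first by rewrite expr0 mul1r.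
  by rewrite exprS -mulrA; apply: Ty.
have T1 : tower i.+1 1 by apply: up.
have subi1 : is_subring (tower i.+1) by split.
have Tyi : tower i.+1 (y i) by rewrite -[y i]mulr1; apply: (Ty).
split=> // c.
have [m] := ubnP ((k - i) - c); elim: m c => // m IH c cm.
have [ck|ck] := leqP (k - i) c.
  by rewrite nth_default // size_tail_poly //; lia.
have -> : (tail_poly i.+1)`_c = (tail_poly i)`_c.+1 + y i * (tail_poly i.+1)`_c.+1.
  by rewrite (tail_polyS ik) mulrBl coefB coefXM coefCM /= subrK.
by apply: (TD); [apply: up | apply: (TM) => //; apply: IH; lia].
Qed.

Lemma tower_subring i : (i <= k)%N ->
  [/\ is_subring (tower i), forall p, S p -> tower i p,
     forall j, (j < i)%N -> tower i (y j) & forall c, tower i (tail_poly i)`_c].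
Proof.
elim: i => [|i IH] ik; first by split.
have [subi Si yi ci] := IH (ltnW ik).
have [subi1 y1 up c1] := tower_step ik subi ci.
split=> // [p /Si/up //|j]; rewrite ltnS leq_eqVlt => /orP[/eqP-> //|/yi/up //].
Qed.

(** The factors y_j with [j >= i] already split off are carried along as a
    monomial while stage [i] is unfolded. *)
Lemma tower_ind_gen (Q : P -> Prop) : Q 0 -> (forall a b, Q a -> Q b -> Q (a + b)) ->
    (forall s (c : nat -> nat), S s -> (forall j, (j < k)%N -> (c j < k - j)%N) ->
       Q (s * \prod_(j < k) y j ^+ c j)) ->
  forall p, tower k p -> Q p.
Proof.
move=> Q0 QD Qgen p Tp.
suff H i : (i <= k)%N -> forall q (c : nat -> nat), tower i q ->
    (forall j, (i <= j < k)%N -> (c j < k - j)%N) ->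
    Q (q * \prod_(i <= j < k) y j ^+ c j).
  have := H k (leqnn k) p (fun _ => 0%N) Tp; rewrite big_geq // mulr1; apply.
  by move=> j; lia.
elim: i => [|i IH] ik q c Tq cb.
  by rewrite big_mkord; apply: Qgen => // j jk; apply: cb.
case: Tq => a Ma ->; rewrite mulr_suml; apply: (big_ind Q) => // m _.
pose c' j := if j == i then val m else c j.
have -> : a m * y i ^+ m * \prod_(i.+1 <= j < k) y j ^+ c j =
    a m * \prod_(i <= j < k) y j ^+ c' j.
  rewrite [in RHS]big_ltn // -mulrA {1}/c' eqxx; congr (_ * (_ * _)).
  apply: eq_big_nat => j ij; by rewrite /c'; case: eqP => // ji; lia.
apply: IH; [exact: ltnW | exact: Ma |].
by move=> j ij; rewrite /c'; case: eqP => [->|ji]; [exact: ltn_ord | apply: cb; lia].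
Qed.

End ArtinTower.

Section ArtinBasis.
Variables (R : idomainType) (k : nat).
Local Notation P := {mpoly R[k]}.

Lemma msymXU (s : 'S_k) (i : 'I_k) : msym s ('X_i : P) = 'X_(s i).
Proof. by rewrite /msym mmapX mmap1U. Qed.

Lemma mpolyXU_inj (i j : 'I_k) : 'X_i = 'X_j :> P -> i = j.
Proof.
move/(congr1 (fun p : P => p@_U_(i)%MM)); rewrite !mcoeffX eqxx.
have [/mnmP/(_ i)|_ /eqP] := eqVneq U_(j)%MM U_(i)%MM; last by rewrite oner_eq0.
by rewrite !mnm1E eqxx; case: eqP.
Qed.

(** The exponents are separated one variable at a time, from the last one down.
    Collecting the powers of the variable of index [i] in a relation between
    monomials in the variables up to [i] gives a polynomial [F] of degree less
    than [k - i] with that variable as a root. Its coefficients involve earlier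
    variables and symmetric polynomials only, so they are fixed by the
    transpositions of [i] with the later indices, and all the [k - i] variables
    from the i-th on are roots of [F]. *)
Lemma artin_free (I : finType) (code : I -> 'I_k -> nat) (s : I -> P) :
    (forall t, s t \is symmetric) -> (forall t j, (code t j < k - j)%N) ->
    (forall t u, code t =1 code u -> t = u) ->
    \sum_t s t * \prod_(j < k) 'X_j ^+ code t j = 0 ->
  forall t, s t = 0.
Proof.
move=> syms bnd inj rel0 t.
suff H m (d : 'I_k -> nat) : (m <= k)%N ->
    \sum_(u | [forall (j : 'I_k | (k - m <= j)%N), code u j == d j])
       s u * \prod_(j < k | (j < k - m)%N) 'X_j ^+ code u j = 0.
  have := H k (code t) (leqnn k); rewrite subnn (bigD1 t) /=; last first.
    by apply/forall_inP.
  rewrite [X in _ * X]big_pred0 // mulr1 [X in _ + X]big_pred0 ?addr0 // => u.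
  by apply/negP => /andP[/forall_inP uP /negP[]]; apply/eqP/inj => j; apply/eqP/uP.
elim: m d => [|m IH] d mk.
  rewrite -[RHS]rel0; apply: eq_big => [u|u _].
    by apply/forall_inP => j; rewrite subn0 leqNgt ltn_ord.
  by congr (_ * _); apply: eq_bigl => j; rewrite subn0 ltn_ord.
have ik : (k - m.+1 < k)%N by lia.
pose i := Ordinal ik.
pose A c :=
  \sum_(u | [forall (j : 'I_k | (k - m <= j)%N), code u j == d j] && (code u i == c))
    s u * \prod_(j < k | (j < i)%N) 'X_j ^+ code u j.
have -> : \sum_(u | [forall (j : 'I_k | (k - m.+1 <= j)%N), code u j == d j])
       s u * \prod_(j < k | (j < k - m.+1)%N) 'X_j ^+ code u j = A (d i).
  apply: eq_bigl => u; apply/forall_inP/andP => [H|[/forall_inP H /eqP Hi] j jm].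
    by split; [apply/forall_inP => j jm; apply: H; lia | apply: H].
  have [->|ji] := eqVneq j i; first by rewrite Hi.
  by apply: H; move: ji; rewrite -val_eqE /=; lia.
have [dk|dk] := leqP (k - i) (d i).
  apply: big_pred0 => u; apply/negP => /andP[_ /eqP di].
  by have := bnd u i; rewrite di; lia.
pose F := \poly_(c < k - i) A c.
suff F0 : F = 0 by have := coef_poly (k - i) A (d i); rewrite -/F F0 coef0 dk.
have Fi : F.[('X_i : P)] = 0.
  rewrite horner_poly -[RHS](IH d (ltnW mk)).
  rewrite [RHS](partition_big (fun u => Ordinal (bnd u i)) predT) //=.
  apply: eq_bigr => c _; rewrite mulr_suml; apply: eq_big => [u|u /andP[_ /eqP ui]].
    by rewrite -val_eqE.
  rewrite -mulrA -ui; congr (_ * _); rewrite [RHS](bigD1 i) /=; last by lia.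
  rewrite mulrC; congr (_ * _); apply: eq_bigl => j; rewrite -val_eqE /=; lia.
have Fj (j : 'I_k) : (i <= j)%N -> root F ('X_j : P).
  move=> ij; rewrite /root; apply/eqP.
  rewrite -[RHS](rmorph0 (msym (tperm i j))) -Fi !horner_poly rmorph_sum.
  apply: eq_bigr => c _; rewrite rmorphM rmorphXn /= msymXU tpermL; congr (_ * _).
  rewrite /A rmorph_sum; apply: eq_bigr => u _; rewrite rmorphM /=.
  have /issymP-> := syms u; congr (_ * _).
  rewrite rmorph_prod; apply: eq_bigr => l li; rewrite rmorphXn /= msymXU tpermD //.
    by apply: contraTneq li => <-; rewrite ltnn.
  by apply: contraTneq li => <-; rewrite -leqNgt.
apply/eqP; apply/negPn/negP => /max_poly_roots.
move/(_ [seq ('X_j : P) | j <- enum [pred j : 'I_k | (i <= j)%N]]).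
rewrite map_inj_uniq ?enum_uniq; last exact: mpolyXU_inj.
rewrite size_map -cardE => H.
have : (#|[pred j : 'I_k | (i <= j)%N]| < size F)%N.
  by apply: H => //; apply/allP => _ /mapP[j + ->]; rewrite mem_enum => /Fj.
rewrite ltnNge; apply/negP; rewrite negbK.
apply: leq_trans (size_poly _ _) _.
have := cardC [pred j : 'I_k | (i <= j)%N]; rewrite card_ord => ck.
rewrite -[X in (X - _ <= _)%N]ck leq_subLR addnC leq_add2r.
rewrite -[X in (_ <= X)%N](card_ord i) -(card_image (f := widen_ord (ltnW ik))).
  apply/subset_leq_card/subsetP => j; rewrite !inE -ltnNge => ji.
  by apply/imageP; exists (Ordinal ji) => //; apply: val_inj.
by move=> a b /(congr1 val) /= /val_inj.
Qed.

(** Artin's monomials generate over the symmetric polynomials. The form of an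
    induction principle makes this applicable to a predicate [Q] of which only
    additivity is known beforehand. *)
Lemma artin_span (Q : P -> Prop) : Q 0 -> (forall a b, Q a -> Q b -> Q (a + b)) ->
    (forall (s : P) (c : nat -> nat), s \is symmetric ->
       (forall j, (j < k)%N -> (c j < k - j)%N) ->
       Q (s * \prod_(j < k) 'X_j ^+ c j)) ->
  forall p, Q p.
Proof.
move=> Q0 QD Qgen p.
pose y j : P := nth 0 [tuple 'X_i | i < k] j.
have yE (j : 'I_k) : y j = 'X_j by rewrite /y -tnth_nth tnth_mktuple.
pose S (q : P) : Prop := q \is symmetric.
have subS : is_subring S.
  by split=> [|a b|a b]; [exact: rpred1 | exact: rpredB | exact: rpredM].
have coefS c : S (tail_poly k y 0)`_c.
  apply/issymP => s; rewrite -coef_map; congr (polyseq _)`_c.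
  rewrite /tail_poly big_mkord rmorph_prod.
  rewrite [RHS](reindex_inj (perm_inj (s := s))) /=.
  apply: eq_bigr => j _; rewrite rmorphB /= map_polyX map_polyC /= !yE.
  by rewrite msymXU.
have [[T1 TB TM] TS Ty _] := tower_subring subS coefS (leqnn k).
apply: (@tower_ind_gen P S k y Q) => // [s c symc cb|].
  by under eq_bigr => j _ do rewrite yE; apply: Qgen.
have subT : is_subring (tower S k y k) by split.
apply: (mpoly_ring_ind (Q := tower S k y k)) => [c|i|a b|a b].
- by apply: TS; rewrite /S; apply/issymP => s; rewrite /msym mmapC.
- by rewrite -yE; apply: Ty.
- exact: (subringD subT).
- exact: TM.
Qed.

End ArtinBasis.

(** * Lehmer codes *)

Section LehmerCode.
Variable k : nat.
Implicit Types s t : 'S_k.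

(** The entries counted by the code, by value instead of by position. *)
Definition code_set s (i : 'I_k) : {set 'I_k} :=
  [set a : 'I_k | (i < a)%N && ((s^-1)%g a < (s^-1)%g i)%N].

Lemma schubert_codeE s i : schubert_code s i = #|code_set s i|.
Proof.
have -> : code_set s i =
    s @: [set j : 'I_k | (j < (s^-1)%g i)%N && (i < s j)%N].
  apply/setP => a; rewrite inE; apply/andP/imsetP => [[ia sa]|[j + ->]].
    by exists ((s^-1)%g a); rewrite ?permKV // inE permKV sa.
  by rewrite inE permK => /andP[].
by rewrite card_imset //; apply: perm_inj.
Qed.

Lemma card_ord_gt (i : 'I_k) : #|[set a : 'I_k | (i < a)%N]| = (k - i.+1)%N.
Proof.
have -> : [set a : 'I_k | (i < a)%N] = ~: [set a : 'I_k | (a < i.+1)%N].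
  by apply/setP => a; rewrite !inE -leqNgt.
have -> : [set a : 'I_k | (a < i.+1)%N] = [set widen_ord (ltn_ord i) b | b : 'I_i.+1].
  apply/setP => a; rewrite inE; apply/idP/imsetP => [ai|[b _ ->]]; last exact: (ltn_ord b).
  by exists (Ordinal ai) => //; apply: val_inj.
have := cardsC [set widen_ord (ltn_ord i) b | b : 'I_i.+1].
rewrite card_ord card_imset ?card_ord; last by move=> a b /(congr1 val) /= /val_inj.
by move=> e; rewrite -[X in (X - _)%N]e addKn.
Qed.

Lemma schubert_code_lt s i : (schubert_code s i < k - i)%N.
Proof.
have ik := ltn_ord i; rewrite schubert_codeE.
apply: leq_ltn_trans (_ : k - i.+1 < k - i)%N; last by lia.
by rewrite -card_ord_gt; apply/subset_leq_card/subsetP => a; rewrite !inE => /andP[].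
Qed.

(** A value is determined by the number of larger values. *)
Lemma perm_order_inj s t :
  (forall a b : 'I_k, (s a < s b)%N = (t a < t b)%N) -> s = t.
Proof.
have cnt (u : 'S_k) (a : 'I_k) : #|[set b : 'I_k | (u a < u b)%N]| = (k - (u a).+1)%N.
  rewrite -card_ord_gt -(card_imset _ (perm_inj (s := u))); apply: eq_card => c.
  rewrite [RHS]inE; apply/imsetP/idP => [[b + ->]|ac]; first by rewrite inE.
  by exists ((u^-1)%g c); rewrite ?permKV // inE permKV.
move=> st; apply/permP => a; apply: val_inj => /=.
have := cnt s a; have := cnt t a.
rewrite (_ : [set b | (s a < s b)%N] = [set b | (t a < t b)%N]); last first.
  by apply/setP => b; rewrite !inE st.
by move=> -> e; have := ltn_ord (s a); have := ltn_ord (t a); lia.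
Qed.

(** The relative order of the places of the values is recovered from the largest
    value down. The values above [i] placed before [i] form an initial segment
    of the order in which the values above [i] are placed, and initial segments
    of one linear order are determined by their size. *)
Lemma schubert_code_inj s t :
  (forall i, schubert_code s i = schubert_code t i) -> s = t.
Proof.
move=> st; apply: invg_inj; apply: perm_order_inj.
suff H m (a b : 'I_k) : (k - m <= a)%N -> (k - m <= b)%N ->
    ((s^-1)%g a < (s^-1)%g b)%N = ((t^-1)%g a < (t^-1)%g b)%N.
  by move=> a b; apply: (H k); rewrite subnn.
elim: m a b => [|m IH] a b; first by have := ltn_ord a; lia.
have neq (u : 'S_k) (c d : 'I_k) : c != d -> (u^-1)%g c != (u^-1)%g d :> nat.
  by rewrite (inj_eq val_inj) (inj_eq perm_inj).
have sub (i : 'I_k) : (k - m.+1 <= i)%N -> code_set s i = code_set t i.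
  move=> im; have eqc : #|code_set s i| = #|code_set t i| by rewrite -!schubert_codeE.
  have cmp (u : 'S_k) c : c \in code_set u i -> (k - m <= c)%N.
    by rewrite inE => /andP[]; lia.
  have [|/subsetPn[c cs ct]] := boolP (code_set s i \subset code_set t i).
    by move=> ss; apply/eqP; rewrite eqEcard ss eqc leqnn.
  apply/eqP; rewrite eq_sym eqEcard eqc leqnn andbT; apply/subsetP => d dt.
  apply: contraT => ds.
  have cd := IH c d (cmp _ _ cs) (cmp _ _ dt).
  move: cs ct dt ds; rewrite !inE => /andP[ic sc]; rewrite ic /= -leqNgt => tc.
  move=> /andP[id td]; rewrite id /= -leqNgt => sd.
  by move: cd; rewrite (leq_trans sc sd) => /esym/ltn_trans; move/(_ _ td); lia.
have one (i c : 'I_k) : (k - m.+1 <= i)%N -> (i < c)%N ->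
    ((s^-1)%g c < (s^-1)%g i)%N = ((t^-1)%g c < (t^-1)%g i)%N.
  by move=> im ic; have /setP/(_ c) := sub i im; rewrite !inE ic.
move=> am bm; case: (ltngtP a b) => [ab|ba|/val_inj->]; last by rewrite !ltnn.
  have nab : b != a by apply: contraTneq ab => ->; rewrite ltnn.
  by have := one a b am ab; have := neq s _ _ nab; have := neq t _ _ nab; lia.
exact: one.
Qed.

(** There are k! bounded sequences, as many as permutations. *)
Lemma schubert_code_surj (c : nat -> nat) :
    (forall j, (j < k)%N -> (c j < k - j)%N) ->
  exists s, forall i, schubert_code s i = c i.
Proof.
move=> cb.
have codek s i : (schubert_code s i < k)%N.
  by apply: leq_trans (schubert_code_lt s i) _; lia.
pose code s := [ffun i => Ordinal (codek s i)].
have code_inj : injective code.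
  move=> s t /ffunP st; apply: schubert_code_inj => i.
  by have := congr1 val (st i); rewrite !ffunE.
pose C := [set g : {ffun 'I_k -> 'I_k} | [forall i : 'I_k, (g i < k - i)%N]].
have cardC : #|C| = k`!.
  pose D (i : 'I_k) := [pred a : 'I_k | (a < k - i)%N].
  rewrite cardsE -(eq_card (A := family D)); last by move=> g; rewrite !inE.
  rewrite card_family.
  rewrite /image_mem foldrE big_map big_enum /=.
  rewrite fact_prod (reindex_inj rev_ord_inj) /= big_add1 big_mkord.
  apply: eq_bigr => i _; have ik := ltn_ord i.
  have -> : #|[pred a : 'I_k | (a < k - rev_ord i)%N]| = (k - rev_ord i)%N.
    rewrite -[RHS]card_ord -(card_image (f := widen_ord (leq_subr (rev_ord i) k))).
      apply: eq_card => a; rewrite inE; apply/idP/imageP => [ai|[b _ ->] /=]; last first.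
        by rewrite ltn_ord.
      by exists (Ordinal ai) => //; apply: val_inj.
    by move=> a b /(congr1 val) /= /val_inj.
  by rewrite /=; lia.
have sub : [set code s | s in [set: 'S_k]] \subset C.
  apply/subsetP => _ /imsetP[s _ ->]; rewrite inE; apply/forallP => i.
  by rewrite ffunE; apply: schubert_code_lt.
have /setP eqC : [set code s | s in [set: 'S_k]] = C.
  by apply/eqP; rewrite eqEcard sub cardC card_imset // cardsT card_Sn leqnn.
have ck j : (j < k)%N -> (c j < k)%N by move=> /cb; lia.
pose g := [ffun i : 'I_k => Ordinal (ck i (ltn_ord i))].
have := eqC g; rewrite [g \in C]inE (_ : [forall i, _] = true); last first.
  by apply/forallP => i; rewrite ffunE; apply: cb.
move=> /imsetP[s _ gs]; exists s => i.
by have /ffunP/(_ i)/(congr1 val) := gs; rewrite !ffunE.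
Qed.

End LehmerCode.

(** * Generating intervals and fork polynomials *)

Section Intervals.
Local Open Scope nat_scope.
Variables n k : nat.
Local Notation V := (istate n k).
Implicit Types x y z w : V.

Definition is_meet x y w : Prop := forall m, v w m = minn (v x m) (v y m).

Lemma meet_exists x y : exists w, is_meet x y w.
Proof.
have [||j _|w vw] := @istate_of_v n k (fun m => minn (v x m) (v y m)).
- by rewrite !v0 minnn.
- by rewrite !v_gt.
- by have := v_step x j; have := v_step y j; lia.
exists w => m; have [/vw //|mn] := leqP m n.+1.
by rewrite !v_gt // ltnW.
Qed.

Lemma meet_covers x y w : is_meet x y w -> not_far x y -> covers w x /\ covers w y.
Proof.
move=> mw /not_far_v nf; split=> m; rewrite !mw; have [] := nf m;
  have := v_mono x (leqnSn m); have := v_mono y (leqnSn m); lia.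
Qed.

Lemma meet_left x y w : is_meet x y w -> left_ist x -> left_ist w.
Proof. by rewrite !left_istE => -> /eqP->; rewrite min0n. Qed.

Lemma v_fully_used x y t : fully_used x y t ->
  v x t = (v x t.+1).+1 /\ v y t = (v y t.+1).+1.
Proof. by case/andP=> tx ty; rewrite v_step tx [v y t]v_step ty. Qed.

Lemma meet_fully_used x y w j : is_meet x y w ->
  v x j.+1 = v y j.+1 -> fully_used x y j = (j \in elts w).
Proof.
move=> mw unc; have := v_step w j; rewrite !mw unc /fully_used.
by rewrite (v_step x j) (v_step y j) unc; do 2 case: (j \in _); case: (j \in _); lia.
Qed.

(** A line following a hole of the meet [w] is uncrossed, because [w] covers both
    [x] and [y]; the interval then extends to the next region that is not fully
    used, which exists since [x] is a left state. After an element of [w] that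
    is not fully used, the next line is crossed. *)
Lemma gen_interval_at x y w j : left_ist x -> is_meet x y w -> not_far x y -> j < n ->
  count (fun l => gen_interval x y (j, l)) (iota 1 n) = (j \notin elts w).
Proof.
move=> lx mw nf jn; have [wx wy] := meet_covers mw nf.
have [jw|jw] := boolP (j \in elts w).
  apply/eqP; rewrite -leqn0 leqNgt -has_count; apply/hasPn => l _; apply/negP.
  case: l => [|l] //= /and5P[_ nfj _ _ /andP[/eqP unc _]].
  by rewrite (meet_fully_used mw unc) jw in nfj.
have unc1 : v x j.+1 = v y j.+1 by rewrite (covers_hole wx jw) (covers_hole wy jw).
have nend : (0 < n - j) && ~~ fully_used x y (j + (n - j)).
  rewrite subn_gt0 jn subnKC ?(ltnW jn) // /fully_used negb_and.
  by rewrite -[n]/(val (@ord_max n)) mem_elts -/(left_ist x) lx.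
have ex : exists l, (0 < l) && ~~ fully_used x y (j + l) by exists (n - j).
have [l0 /andP[l0p l0h] l0min] := ex_minnP ex.
have l0n : j + l0 <= n by have := l0min _ nend; lia.
have full t : j < t < j + l0 -> fully_used x y t.
  move=> /andP[jt tl]; apply: contraT => nt.
  have := l0min (t - j); rewrite subn_gt0 jt subnKC ?(ltnW jt) // nt.
  by move=> /(_ isT); lia.
have unc d : d < l0 -> v x (j + d).+1 = v y (j + d).+1.
  elim: d => [|d IH] dl; first by rewrite addn0.
  have /v_fully_used[] : fully_used x y (j + d).+1 by apply: full; lia.
  by have := IH (ltnW dl); rewrite addnS; lia.
transitivity (count_mem l0 (iota 1 n)); last first.
  by rewrite count_uniq_mem ?iota_uniq // mem_iota; lia.
apply: eq_in_count => l; rewrite mem_iota => /andP[lp ln].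
apply/idP/eqP => [/and5P[_ _ _ nl /andP[/allP fl _]]|->].
  apply/eqP; rewrite eqn_leq andbC l0min ?lp //= leqNgt; apply/negP => ll.
  by move/negP: l0h; apply; apply: fl; rewrite mem_iota; lia.
apply/and5P; split=> //; first by rewrite (meet_fully_used mw unc1).
apply/andP; split; apply/allP => t; rewrite mem_iota => tl; first by apply: full; lia.
apply/eqP; have := unc (t - j.+1); rewrite (_ : (j + (t - j.+1)).+1 = t); last by lia.
by apply; lia.
Qed.

Lemma map_fst_filter_allpairs (P : pred (nat * nat)) (Q : pred nat) s t :
    (forall j, j \in s -> count (fun l => P (j, l)) t = Q j) ->
  [seq jl.1 | jl <- [seq jl <- [seq (j, l) | j <- s, l <- t] | P jl]] =
    [seq j <- s | Q j].
Proof.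
elim: s => //= j s IH H.
rewrite filter_cat map_cat IH; last by move=> i si; apply: H; rewrite inE si orbT.
rewrite filter_map -map_comp.
have -> (r : seq nat) : [seq (fst \o pair j) l | l <- r] = nseq (size r) j.
  by elim: r => //= a r ->.
by rewrite size_filter /= H ?mem_head //; case: (Q j).
Qed.

(** All holes of a left state but the last one, which is [n]. *)
Definition inner_holes w := [seq j <- iota 0 n | j \notin elts w].

Lemma gen_intervals_fst x y w : left_ist x -> is_meet x y w -> not_far x y ->
  [seq jl.1 | jl <- gen_intervals x y] = inner_holes w.
Proof.
move=> lx mw nf; apply: map_fst_filter_allpairs => j; rewrite mem_iota /= add0n => jn.
exact: gen_interval_at.
Qed.

Lemma holes_left w : left_ist w -> holes w = rcons (inner_holes w) n.
Proof.
move=> lw; rewrite holes_filter -addn1 iotaD filter_cat /= add0n.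
by rewrite -[n in n \notin _]/(val (@ord_max n)) mem_elts -/(left_ist w) lw cats1.
Qed.

Lemma count_iota_lt a b m : count (fun j => j <= m) (iota a b) = minn b (m.+1 - a).
Proof. by elim: b a => [|b IH] a /=; rewrite ?IH; lia. Qed.

Lemma count_holes_le w m : m <= n ->
  count (fun j => j <= m) (holes w) + k = m.+1 + v w m.+1.
Proof.
move=> mn; have e1 : count (fun j => j <= m) (elts w) + v w m.+1 = k.
  rewrite v_count; transitivity (size (elts w)); last exact: size_elts.
  rewrite -(count_predC (fun j => j <= m)); congr (_ + _).
  by apply: eq_count => j /=; rewrite -ltnNge.
have e2 : count (fun j => j <= m) (elts w) + count (fun j => j <= m) (holes w) = m.+1.
  rewrite elts_filter holes_filter -count_cat.
  have /permPl/seq.permP-> := perm_filterC (fun j => j \in elts w) (iota 0 n.+1).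
  by rewrite count_iota_lt; lia.
lia.
Qed.

Lemma size_inner_holes w : left_ist w -> size (inner_holes w) = n - k.
Proof.
move=> lw; have := count_holes_le w (leqnn n); rewrite v_gt // (holes_left lw).
rewrite (eq_in_count (a2 := predT)) ?count_predT ?size_rcons; first by lia.
move=> j; rewrite -holes_left // holes_filter mem_filter mem_iota => /andP[_].
by rewrite add0n ltnS.
Qed.

Lemma hole_inner w i : left_ist w -> i < n - k -> hole w i = nth 0 (inner_holes w) i.
Proof. by move=> lw ik; rewrite /hole holes_left // nth_rcons size_inner_holes // ik. Qed.

(** Comparing the i-th hole to [m] amounts to counting the holes up to [m]. *)
Lemma hole_leE w i m : left_ist w -> i < n - k -> m < n ->
  (hole w i <= m) = (i < m.+1 + v w m.+1 - k).
Proof.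
move=> lw ik mn; have cnt := count_holes_le w (ltnW mn).
have srt : sorted ltn (holes w).
  by rewrite holes_filter sorted_filter ?iota_ltn_sorted //; apply: ltn_trans.
have sz : size (holes w) = (n - k).+1.
  by rewrite holes_left // size_rcons size_inner_holes.
have -> : m.+1 + v w m.+1 - k = count (fun j => j <= m) (holes w) by lia.
rewrite leqNgt /hole sorted_nth_count // ?sz; last by lia.
have := count_predC (leq m.+1) (holes w); rewrite sz.
rewrite (eq_count (a1 := predC _) (a2 := fun j => j <= m)); first by lia.
by move=> j /=; rewrite -ltnNge ltnS.
Qed.

Lemma v_left_le w m : left_ist w -> m <= n -> m + v w m <= n.
Proof.
rewrite left_istE => /eqP wn mn.
rewrite -{1}(subKn mn) -[m in v w m](subKn mn).
elim: (n - m) => [|d IH]; first by rewrite subn0 wn addn0.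
have [dn|dn] := leqP n d; first by move: IH; rewrite (_ : n - d = n - d.+1) //; lia.
by rewrite v_step (_ : (n - d.+1).+1 = n - d); last lia; case: (_ \in _); lia.
Qed.

Lemma sum_between N a b : b <= N -> \sum_(i < N) (a <= i < b) = b - a.
Proof.
move=> bN; rewrite -(big_mkord xpredT (fun i => nat_of_bool (a <= i < b))).
elim: N b bN => [|N IH] b bN; first by rewrite big_nil; lia.
rewrite big_nat_recr //=; have [bN'|bN'] := leqP b N.
  by rewrite IH //; lia.
have {bN bN'} -> : b = N.+1 by lia.
have := IH N (leqnn N).
rewrite (eq_big_nat _ _ (F2 := fun i => nat_of_bool (a <= i < N.+1))); first by lia.
by move=> i; lia.
Qed.

End Intervals.

Section ForkPoly.
Variables n k : nat.
Local Notation V := (istate n k).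
Local Notation ZU := {mpoly int[n]}.
Implicit Types x y z w : V.

(** The variables of the generating intervals of [x] and [y] up to the holes of
    [z]. Line m + 1 is among them when the meet of [x] and [y] has more holes
    up to [m] than [z] does, and the exponent is the difference. *)
Definition gap x y z : ZU :=
  \prod_(m < n) 'X_m ^+ (minn (v x m.+1) (v y m.+1) - v z m.+1).

(** Exchanging the products over intervals and lines, the exponent of a variable
    is a number of holes of the meet minus a number of holes of [z]. *)
Lemma fork_polyE x y z (s : 'S_k) : left_ist x -> left_ist z -> not_far x y ->
  fork_poly x z s y = extend z (schubert' s) * gap x y z.
Proof.
move=> lx lz nf; have [w mw] := meet_exists x y; have lw := meet_left mw lx.
rewrite /fork_poly; congr (_ * _).
have hz (i : 'I_(n - k)) : (hole z i < n)%N.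
  have n0 : (0 < n)%N by have := ltn_ord i; lia.
  have := hole_leE (m := n.-1) lz (ltn_ord i); rewrite prednK // leqnn.
  by move=> /(_ isT); have := ltn_ord i; move: lz; rewrite left_istE => /eqP->; lia.
transitivity (\prod_(i < n - k) \prod_(m < n)
    ('X_m : ZU) ^+ (hole w i <= m < hole z i)%N).
  apply: eq_bigr => i _ /=.
  have -> : (nth (0, 0)%N (gen_intervals x y) i).1 = hole w i.
    rewrite (hole_inner lw) // -(gen_intervals_fst lx mw nf) (nth_map (0, 0)%N) //.
    by rewrite -(size_map fst) (gen_intervals_fst lx mw nf) size_inner_holes.
  by rewrite big_add1 /= prod_U_nat // ltnW.
rewrite exchange_big; apply: eq_bigr => m _; rewrite prodrXr /=; congr (_ ^+ _).
have mn := ltn_ord m.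
under eq_bigr => i _ do
  rewrite (hole_leE lw (ltn_ord i) mn) [(_ < hole z i)%N]ltnNge
    (hole_leE lz (ltn_ord i) mn) -leqNgt andbC.
rewrite sum_between -?mw.
  by have := count_holes_le w (ltnW mn); have := count_holes_le z (ltnW mn); lia.
by have := v_left_le lw mn; lia.
Qed.

End ForkPoly.

(** * The filtration by gaps *)

Section Combinatorics.
Variables n k : nat.
Local Notation V := (istate n k).
Local Notation ZU := {mpoly int[n]}.
Local Notation ZY := {mpoly int[k]}.
Implicit Types x y z w : V.
Local Notation I := (gen_ideal (@B_rel n k)).

Definition rank z : nat := \sum_(m < n) v z m.+1.

Lemma rank_lt z w : covers z w -> z != w -> (rank z < rank w)%N.
Proof.
move=> zw; apply: contraR; rewrite -leqNgt => wz; apply/eqP/v_inj => m mn.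
have le (i : 'I_n) : true -> (v z i.+1 <= v w i.+1)%N by move=> _; case/andP: (zw i).
have /leqif_sum[_] : forall i : 'I_n, true ->
    (v z i.+1 <= v w i.+1 ?= iff (v z i.+1 == v w i.+1))%N.
  by move=> i _; split=> //; apply: le.
have -> : (\sum_(i < n) v z i.+1 == \sum_(i < n) v w i.+1)%N.
  by rewrite eqn_leq wz leq_sum.
by move=> /esym/forall_inP/(_ (Ordinal mn) isT)/eqP.
Qed.

Lemma moves_exist_down (i : 'I_n) x : nat_of_ord i \notin elts x -> i.+1 \in elts x ->
  exists y, moves i y x.
Proof.
move=> ix i1x; have il := ltn_ord i.
have vi : (v x i.+1 = (v x i.+2).+1)%N by rewrite v_step i1x.
have vi' : (v x i = v x i.+1)%N by rewrite v_step (negPf ix).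
have [||j jn|y vy] := @istate_of_v n k (fun m => v x m - (m == i.+1))%N.
- by rewrite v0 subn0.
- by rewrite v_gt.
- have := v_step x j; have [ji|ji] := eqVneq j i.+1.
    have -> : (j.+1 == i.+1) = false by lia.
    by rewrite ji i1x; lia.
  have [{}ji|{}ji] := eqVneq j.+1 i.+1; last by case: (_ \in _); lia.
  by case: ji => ->; rewrite (negPf ix); lia.
exists y => m; have [mn|mn] := leqP m n.+1.
  by rewrite vy //; have [->|_] := eqVneq m i.+1; lia.
by rewrite !v_gt //; lia.
Qed.

Lemma gap_step x y z z' (m : 'I_n) : moves m z' z -> covers z x -> covers z y ->
  gap x y z' = gap x y z * 'X_m.
Proof.
move=> zz zx zy; rewrite /gap prodX_mulX; apply: eq_bigr => s _; congr (_ ^+ _).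
have := zz s.+1; rewrite eqSS (inj_eq val_inj).
by have := zx s; have := zy s; case: (s == m); lia.
Qed.

(** The generating interval in question ends at line m + 1. It begins after the
    last region up to [m] that is not fully used; between the two, [v x] and
    [v y] coincide and exceed [v z], so the gap contains all variables of the
    interval but the last. *)
Lemma ideal_gap_stop x y z (m : 'I_n) q : covers z x -> covers z y ->
    nat_of_ord m \notin elts z -> ~~ fully_used x y m.+1 ->
  I ((gap x y z * ('X_m * q)) *: f x y).
Proof.
move=> zx zy mz nf1.
have vx := covers_hole zx mz; have vy := covers_hole zy mz.
have down d : (d <= m.+1)%N -> (forall t, (m.+1 - d <= t <= m)%N -> fully_used x y t) ->
    v x (m.+1 - d) = v y (m.+1 - d) /\
    ((0 < d)%N -> (v z (m.+1 - d) < v x (m.+1 - d))%N).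
  elim: d => [|d IH] dm fu; first by rewrite subn0 vx vy.
  have [||e1 e2] := IH; first exact: ltnW.
    by move=> t tm; apply: fu; lia.
  have /v_fully_used[ex ey] : fully_used x y (m.+1 - d.+1) by apply: fu; lia.
  rewrite (_ : (m.+1 - d.+1).+1 = m.+1 - d)%N in ex ey; last by lia.
  split; first by rewrite ex ey e1.
  move=> _; rewrite ex; case: d => [|d] in dm fu IH e1 e2 ex ey *.
    rewrite subn0 in e1 e2 ex ey *; rewrite subn1 vx /=.
    by have := v_step z m; rewrite (negPf mz) add0n => ->.
  have := e2 isT; have := v_step z (m.+1 - d.+2).
  rewrite (_ : (m.+1 - d.+2).+1 = m.+1 - d.+1)%N; last by lia.
  by case: (_ \in _); clear; lia.
have exj : exists j, (j <= m)%N && ~~ fully_used x y j.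
  apply/not_existsP => nj; have [||_] := down m.+1 => //.
    by move=> t /andP[_ tm]; apply: contraT => nt; case: (nj t); rewrite tm.
  by rewrite subnn !v0 ltnn => /(_ isT).
have ubj j : (j <= m)%N && ~~ fully_used x y j -> (j <= m)%N by case/andP.
have [j /andP[jm nfj] jmax] := ex_maxnP exj ubj.
have full t : (j < t <= m)%N -> fully_used x y t.
  move=> /andP[jt tm]; apply: contraT => nt.
  by have := jmax t; rewrite tm nt => /(_ isT); lia.
have at_ t : (j < t <= m.+1)%N -> v x t = v y t /\ ((t <= m)%N -> (v z t < v x t)%N).
  move=> jt; have [||e1 e2] := down (m.+1 - t)%N; first by lia.
    by move=> s st; apply: full; lia.
  by rewrite subKn in e1 e2; [split=> // tm; apply: e2|]; lia.
pose e (s : 'I_n) := (minn (v x s.+1) (v y s.+1) - v z s.+1 + (s == m))%N.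
have ge (s : 'I_n) : ((j <= s < m.+1)%N <= e s)%N.
  rewrite /e; case: (boolP (j <= s < m.+1)%N) => //= js.
  have [->|sm] := eqVneq s m; first by rewrite addn1.
  have sm' : (s < m)%N by move: sm js; rewrite -val_eqE /=; lia.
  by have [|e1 /(_ sm')] := at_ s.+1; lia.
have -> : gap x y z * ('X_m * q) =
    (\prod_(s < n) 'X_s ^+ (e s - (j <= s < m.+1))%N * q) *
    \prod_(j <= t < j + (m.+1 - j)) U n t.+1.
  rewrite subnKC ?(leqW jm) // prod_U_nat //.
  rewrite mulrAC -big_split /= mulrA /gap prodX_mulX; congr (_ * _).
  by apply: eq_bigr => s _; rewrite -exprD subnK.
rewrite -scalerA; apply: idealZ; have mn := ltn_ord m.
apply: ideal_interval => //; rewrite ?subnKC ?(leqW jm) //.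
- by rewrite subn_gt0.
- by move=> t tj; have [] := at_ t tj.
Qed.

Lemma restrict_gap_neq0 x y z : covers z x -> covers z y -> restrict z (gap x y z) != 0.
Proof.
move=> zx zy; rewrite /gap rmorph_prod; apply/prodf_neq0 => m _; rewrite rmorphXn /=.
have [mz|mz] := boolP (nat_of_ord m \in elts z); last first.
  by rewrite (covers_hole zx mz) (covers_hole zy mz) minnn subnn expr0 oner_neq0.
have [j ej] := el_surj mz.
by rewrite (restrict_el ej) expf_neq0 // -msupp_eq0 msuppX.
Qed.

(** At a hole of [z] the functions [v x], [v y] and [v z] coincide. If [z'] is
    not covered by [z], then [v z'] is smaller than them at some hole of [z],
    and the corresponding variable occurs in the gap. *)
Lemma restrict_gap_eq0 x y z z' :
  covers z x -> covers z y -> covers z' x -> covers z' y -> ~ covers z z' ->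
  restrict z (gap x y z') = 0.
Proof.
move=> zx zy z'x z'y; apply: contra_notP => /eqP nz; apply: covers_of_holes => m mn mz.
apply/eqP; apply: contraNT nz => vm.
rewrite /gap rmorph_prod (bigD1 (Ordinal mn)) //= rmorphXn /= restrict_hole //.
have e0 : (minn (v x m.+1) (v y m.+1) - v z' m.+1 != 0)%N.
  have := covers_hole zx mz; have := covers_hole zy mz; have := z'x m; have := z'y m.
  by move/eqP: vm; lia.
by rewrite expr0n (negPf e0) mul0r.
Qed.

Lemma fork_condE x z y s : left_ist x -> left_ist y -> left_ist z -> not_far x y ->
  covers z x -> covers z y -> fork_cond (x, z, y, s).
Proof.
rewrite /fork_cond /= => -> -> -> -> /coversP/andP[-> ->] /coversP/andP[nf ->].
by rewrite !andbT /=; apply/not_far_v => m; have /not_far_v/(_ m)[] := nf.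
Qed.

Lemma fork_condP x z y s : fork_cond (x, z, y, s) ->
  [/\ left_ist x, left_ist y, left_ist z & not_far x y] /\ (covers z x /\ covers z y).
Proof.
case/and5P => /= lx ly lz nf /and4P[nfx nfy gx gy]; split=> //; split; apply/coversP.
  by rewrite nfx.
rewrite gy andbT; apply/not_far_v => m.
by have /not_far_v/(_ m)[] := nfy.
Qed.

Lemma comp_mesym_sym (c : ZY) :
  c \mPo [tuple mesym k int i.+1 | i < k] \is symmetric.
Proof.
elim/mpoly_ring_ind: c => [c|i|p q|p q].
- by rewrite comp_mpolyC; apply/issymP => s; rewrite /msym mmapC.
- by rewrite comp_mpolyXU -tnth_nth tnth_mktuple mesym_sym.
- by rewrite rmorphD; apply: rpredD.
- by rewrite rmorphM; apply: rpredM.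
Qed.

End Combinatorics.

(** * The fork basis *)

Section Basis.
Variables n k : nat.
Local Notation V := (istate n k).
Local Notation ZU := {mpoly int[n]}.
Local Notation ZY := {mpoly int[k]}.
Local Notation Bmod := (Bl n k : lmodType ZY).
Implicit Types x y z w : V.
Local Notation I := (gen_ideal (@B_rel n k)).

(** A combination of fork elements, lifted before passing to the quotient. *)
Definition lift_comb (c : fork_index n k -> ZY) : B0 n k :=
  \sum_t (eps_act n (c t) * fork_poly (fork_x t) (fork_z t) (fork_s t) (fork_y t)) *:
     f (fork_x t) (fork_y t).

Lemma corner_val_comb (c : fork_index n k -> ZY) :
  corner_val (\sum_t c t *: (fork_elt t : Bmod)) = piB (lift_comb c).
Proof.
have -> : corner_val (\sum_t c t *: (fork_elt t : Bmod)) =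
    \sum_t corner_val (c t *: (fork_elt t : Bmod)) by apply: big_morph.
rewrite /lift_comb raddf_sum; apply: eq_bigr => t _ /=.
by rewrite -(piBM (eps_act n (c t) *: (1 : B0 n k))) -B0_scaleAl mul1r scalerA.
Qed.

Lemma piB_eq0 (a : B0 n k) : piB a = 0 <-> I a.
Proof.
rewrite -(rmorph0 (@piB n k)) -[a in I a]subr0; exact: qpi_eq.
Qed.

(** Coefficients vanish by descending rank of z. At the evaluation at z, only the
    forks whose state is covered by z contribute, and all of these but those at
    z itself have larger rank; the gap of z factors out, leaving a relation
    between Artin's monomials. *)
Lemma fork_free (c : fork_index n k -> ZY) :
  \sum_t c t *: (fork_elt t : Bmod) = 0 -> forall t, c t = 0.
Proof.
move/(congr1 (@corner_val _ _)); rewrite corner_val_comb => /piB_eq0 IA.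
suff H r t : (n * k < r + rank (fork_z t))%N -> c t = 0.
  by move=> t; apply: (H (n * k).+1); rewrite addSn ltnS leq_addr.
elim: r t => [|r IH] t rt.
  have : (rank (fork_z t) <= n * k)%N.
    rewrite -[X in (X * _)%N]card_ord -sum_nat_const; apply: leq_sum => m _.
    by have := v_mono (fork_z t) (leq0n m.+1); rewrite v0.
  by move: rt; rewrite add0n ltnNge => /negP.
case: t rt => -[[[x z] y] s0] tP; rewrite /fork_z /= => rt.
have [[lx ly lz nf] [zx zy]] := fork_condP tP.
have := gen_ideal_restrict IA zx zy.
rewrite /lift_comb Defs.coef_sum rmorph_sum /=.
pose mk (s : 'S_k) : fork_index n k := ForkIndex (fork_condE s lx ly lz nf zx zy).
pose T t := [&& fork_x t == x, fork_y t == y & fork_z t == z].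
rewrite (bigID T) /= [X in _ + X]big1 ?addr0 => [|t]; last first.
  rewrite Defs.coefZ coef_f /T ![_ == fork_x t]eq_sym ![_ == fork_y t]eq_sym.
  have [xt|] := eqVneq (fork_x t) x; last by rewrite mulr0 rmorph0.
  have [yt /= zt|] := eqVneq (fork_y t) y; last by rewrite mulr0 rmorph0.
  rewrite mulr1 rmorphM /=.
  have [[_ _ lzt _] [ztx zty]] : [/\ left_ist (fork_x t), left_ist (fork_y t),
      left_ist (fork_z t) & not_far (fork_x t) (fork_y t)] /\
      (covers (fork_z t) (fork_x t) /\ covers (fork_z t) (fork_y t)).
    by case: (t) => -[[[? ?] ?] ?]; apply: fork_condP.
  rewrite xt yt in ztx zty *; rewrite fork_polyE //.
  have [zzt|zzt] := pselect (covers z (fork_z t)); last first.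
    by rewrite rmorphM /= (restrict_gap_eq0 zx zy ztx zty zzt) !mulr0.
  rewrite (IH t) ?rmorph0 ?mul0r //.
    by rewrite /eps_act !rmorph0 mul0r.
  by have := rank_lt zzt; rewrite eq_sym => /(_ zt); lia.
rewrite (reindex mk) /=; last first.
  exists (@fork_s n k) => [s _ //|t /and3P[/eqP xt /eqP yt /eqP zt]].
  apply: val_inj; rewrite /= -xt -yt -zt.
  by rewrite /fork_x /fork_y /fork_z /fork_s; case: (fork t) => -[[? ?] ?] ?.
rewrite (eq_bigl xpredT) => [|s]; last by rewrite /T !eqxx.
rewrite (eq_bigr (fun s => ((c (mk s) \mPo [tuple mesym k int i.+1 | i < k]) *
    \prod_(j < k) 'X_j ^+ schubert_code s j) * restrict z (gap x y z))) => [|s _]; last first.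
  rewrite Defs.coefZ coef_f !eqxx mulr1 fork_polyE // !rmorphM /= restrict_eps //.
  by rewrite restrictK // mulrA.
rewrite -mulr_suml => /eqP.
rewrite mulf_eq0 (negPf (restrict_gap_neq0 zx zy)) orbF => /eqP.
move/(artin_free (fun s => comp_mesym_sym (c (mk s))) (@schubert_code_lt k)
  (@schubert_code_inj k)) => /(_ s0)/msym_fundamental_un0.
by rewrite (_ : mk s0 = ForkIndex tP) //; apply: val_inj.
Qed.

Definition spanned (a : B0 n k) : Prop := exists c, I (a - lift_comb c).

Lemma spanned_ideal a : I a -> spanned a.
Proof.
move=> Ia; exists (fun _ => 0); rewrite /lift_comb big1 ?subr0 // => t _.
by rewrite /eps_act rmorph0 mul0r scale0r.
Qed.

Lemma spannedB a b : spanned a -> spanned b -> spanned (a - b).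
Proof.
move=> [c Ic] [d Id]; exists (fun t => c t - d t).
suff -> : lift_comb (fun t => c t - d t) = lift_comb c - lift_comb d.
  have sub4 (W : zmodType) (p q r s : W) : p - q - (r - s) = (p - r) - (q - s).
    by rewrite opprD addrACA -opprD.
  by rewrite sub4; exact (gen_idealB Ic Id).
rewrite /lift_comb -sumrB; apply: eq_bigr => t _.
by rewrite /eps_act rmorphB mulrBl scalerBl.
Qed.

Lemma spanned0 : spanned 0.
Proof. by apply: spanned_ideal; apply: gen_ideal0. Qed.

Lemma spannedD a b : spanned a -> spanned b -> spanned (a + b).
Proof.
move=> sa sb; rewrite -[b]opprK -[- b]sub0r; apply: spannedB => //.
by apply: spannedB => //; apply: spanned0.
Qed.

Lemma spanned_sum (T : Type) (r : seq T) (P : pred T) (F : T -> B0 n k) :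
  (forall t, P t -> spanned (F t)) -> spanned (\sum_(t <- r | P t) F t).
Proof.
by move=> SF; apply: (big_ind spanned) => //; [exact: spanned0 | exact: spannedD].
Qed.

Lemma spanned_fork (c : ZY) (t : fork_index n k) : spanned
  ((eps_act n c * fork_poly (fork_x t) (fork_z t) (fork_s t) (fork_y t)) *:
     f (fork_x t) (fork_y t)).
Proof.
exists (fun u => if u == t then c else 0); rewrite /lift_comb (bigD1 t) //= eqxx big1.
  by rewrite addr0 subrr; apply: gen_ideal0.
by move=> u /negPf->; rewrite /eps_act rmorph0 mul0r scale0r.
Qed.

(** By ascending rank of z: multiples of a variable killed by [restrict z] fall
    into the gap of a state of smaller rank, or into the ideal. Modulo these,
    e_i of all n variables and e_i of the k surviving ones agree, and so do a
    polynomial and its restriction. *)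
Lemma spanned_gap x y z p : left_ist x -> left_ist y -> not_far x y ->
  left_ist z -> covers z x -> covers z y -> spanned ((gap x y z * p) *: f x y).
Proof.
move=> lx ly nf; have [r] := ubnP (rank z).
elim: r z p => // r IH z p; rewrite ltnS => rz lz zx zy.
have hole (m : 'I_n) q : nat_of_ord m \notin elts z ->
    spanned ((gap x y z * ('X_m * q)) *: f x y).
  move=> mz.
  have [mx|mx] := boolP ((v x m.+2 < v z m.+1) && (v y m.+2 < v z m.+1))%N; last first.
    apply: spanned_ideal; apply: ideal_gap_stop => //.
    apply: contra mx => /v_fully_used[].
    by rewrite (covers_hole zx mz) (covers_hole zy mz); lia.
  have m1z : m.+1 \in elts z.
    apply: contraT => m1z; have := v_step z m.+1; rewrite (negPf m1z).
    by case/andP: mx; have := zx m.+1; lia.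
  have [z' zz'] := moves_exist_down mz m1z.
  have vz' s : (v z' s <= v z s)%N by rewrite zz' leq_addr.
  have cov u : covers z u -> (v u m.+2 < v z m.+1)%N -> covers z' u.
    move=> zu um s; have := zu s; have := vz' s.+1; have := zz' s.
    by have [->|_] := eqVneq s m.+1; lia.
  have z'x := cov x zx (andP mx).1; have z'y := cov y zy (andP mx).2.
  rewrite mulrA -(gap_step zz' zx zy); apply: IH => //; last first.
    by move: lz; rewrite !left_istE -!leqn0; apply: leq_trans.
  apply: leq_trans rz; rewrite /rank (bigD1 m) //= [X in (_ < X)%N](bigD1 m) //=.
  by rewrite zz' eqxx addn1 addSn ltnS leq_add2l; apply: leq_sum => s _.
have holes q (g : 'I_n -> ZU) : spanned
   ((gap x y z * ((\sum_(m < n | nat_of_ord m \notin elts z) 'X_m * g m) * q)) *: f x y).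
  rewrite mulr_suml mulr_sumr scaler_suml; apply: spanned_sum => m mz.
  by rewrite -mulrA; apply: hole.
have [g ->] := extend_restrict z p.
rewrite mulrDr scalerDl; apply: spannedD; last first.
  by rewrite -[\sum_(m < n | _) _]mulr1; apply: holes.
elim/artin_span: (restrict z p) => [|a b sa sb|s e syms eb].
- by rewrite rmorph0 mulr0 scale0r; apply: spanned0.
- rewrite (rmorphD (extend z)) /= mulrDr scalerDl.
  exact (spannedD sa sb).
have [c [<- _]] := sym_fundamental syms.
have [sg sgE] := schubert_code_surj eb.
have {g} [g gE] := extend_restrict z (eps_act n c); rewrite restrict_eps // in gE.
rewrite rmorphM /=.
have -> : extend z (c \mPo [tuple mesym k int i.+1 | i < k]) =
    eps_act n c - \sum_(m < n | nat_of_ord m \notin elts z) 'X_m * g m.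
  by rewrite gE addrK.
rewrite mulrBl mulrBr scalerBl; apply: spannedB; last exact: holes.
have -> : gap x y z * (eps_act n c * extend z (\prod_(j < k) 'X_j ^+ e j)) =
    eps_act n c * fork_poly x z sg y.
  have sE : schubert' sg = \prod_(j < k) 'X_j ^+ e j.
    by apply: eq_bigr => j _; rewrite sgE.
  by rewrite (fork_polyE _ lx lz nf) sE mulrCA [gap x y z * _]mulrC.
exact: (spanned_fork c (ForkIndex (fork_condE sg lx ly lz nf zx zy))).
Qed.

(** The meet of [x] and [y] has gap 1, which starts the filtration. *)
Lemma spanned_f x y p : left_ist x -> left_ist y -> spanned (p *: f x y).
Proof.
move=> lx ly; have [nf|far] := boolP (not_far x y).
  have [w mw] := meet_exists x y; have [wx wy] := meet_covers mw nf.
  have := spanned_gap p lx ly nf (meet_left mw lx) wx wy.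
  by rewrite /gap big1 ?mul1r // => m _; rewrite mw subnn expr0.
apply: spanned_ideal; apply: idealZ.
have /existsNP[m] : ~ forall m, (v x m.+1 <= v y m)%N /\ (v y m.+1 <= v x m)%N.
  by move=> H; case/negP: far; apply/not_far_v.
case/not_andP => /negP; rewrite -ltnNge => /ideal_too_far[] //.
Qed.

Lemma fork_span (b : Bmod) :
  exists c : fork_index n k -> ZY, b = \sum_t c t *: (fork_elt t : Bmod).
Proof.
have /asboolP[a aE] := cornerP (b : Bl n k).
pose e : B0 n k := \sum_(x : V | left_ist x) f x x.
pose a0 := qrepr a.
have bE : corner_val b = piB (e * a0 * e) by rewrite aE !piBM /a0 /piB qreprK.
have : spanned (e * a0 * e).
  rewrite /e mulr_suml mulr_suml; apply: spanned_sum => x lx.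
  rewrite mulr_sumr; apply: spanned_sum => y ly.
  by rewrite corner_f; apply: spanned_f.
case=> c /(piB_eq0 _).2; rewrite raddfB => /eqP; rewrite subr_eq0 => /eqP ec.
exists c; apply: val_inj; apply: etrans bE _; apply: etrans ec _.
exact (esym (corner_val_comb c)).
Qed.

End Basis.

Theorem theorem7p4 (n k : nat) (hkn : (k <= n)%N) :
  is_basis (@fork_elt n k : fork_index n k -> (Bl n k : lmodType {mpoly int[k]})).
Proof. by split; [exact: fork_span | exact: fork_free]. Qed.
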